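(* Let $d\ge 2$ be an integer. There is a constant $c_d>0$, depending only on $d$ (and on the fixed choice of the Young function $\varphi_{(d-2)/2}$ used to define the Orlicz norm), such that for every integer $N\ge 1$ and every set $\mathcal A_N\subset[0,1]^d$ of cardinality $N$, the discrepancy function $$D_N(\vec x)=\sharp\bigl(\mathcal A_N\cap[\vec 0,\vec x)\bigr)-N\,\bigl|[\vec 0,\vec x)\bigr|,\qquad \vec x\in[0,1]^d,$$ satisfies $$\|D_N\|_{L(\log L)^{(d-2)/2}}\ \ge\ c_d\,(\log N)^{(d-1)/2}.$$
   Context: For $\vec x=(x_1,\dots,x_d)\in[0,1]^d$, $[\vec 0,\vec x)=\prod_{t=1}^d[0,x_t)$, $|\cdot|$ denotes Lebesgue measure, and $\sharp$ denotes cardinality. Orlicz norm: the underlying probability space is $[0,1]^d$ with Lebesgue measure, with expectation $\mathbb E$. For a symmetric convex function $\psi$ on $\mathbb R$ that is zero at the origin and otherwise non-zero, set $$\|f\|_{L^\psi}=\inf\{K>0 : \mathbb E\,\psi(f\cdot K^{-1})\le 1\},$$ with the infimum over the empty set equal to $\infty$. For $\alpha>0$, let $\varphi_\alpha$ be a fixed such function with $\varphi_\alpha(x)=|x|\,(\log(3+|x|))^\alpha$ for all $|x|$ sufficiently large (depending on $\alpha$); the space $L(\log L)^\alpha$ is $L^{\varphi_\alpha}$, with norm $\|\cdot\|_{L^{\varphi_\alpha}}$ (different choices of $\varphi_\alpha$ give equivalent norms). For $\alpha=0$ (the case $d=2$), $L(\log L)^0$ means $L^1([0,1]^d)$ with its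 usual norm. *)

(* Defs.v *)
From HB Require Import structures.
From mathcomp Require Import all_boot all_order all_algebra finmap.
From mathcomp Require Import all_classical all_reals all_analysis.

Set Implicit Arguments.
Unset Strict Implicit.
Unset Printing Implicit Defensive.

Import Order.TTheory GRing.Theory Num.Theory.
Import numFieldNormedType.Exports.

Local Open Scope classical_set_scope.
Local Open Scope ring_scope.

(* Points of R^n are n-tuples, with the product sigma-algebra; the carrier
   measurableTypeR R is R itself, in the form expected by lebesgue_measure. *)
Notation Rtuple R n := (n.-tuple (measurableTypeR R)).

Section cons_measure.
Context {R : realType} (n : nat).
Variable m : {sigma_finite_measure set (Rtuple R n) -> \bar R}.

Definition cons_pair (p : measurableTypeR R * Rtuple R n) : Rtuple R n.+1 :=
  [the n.+1.-tuple _ of p.1 :: p.2].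

Lemma measurable_cons_pair :
  measurable_fun [set: measurableTypeR R * Rtuple R n] cons_pair.
Proof.
by apply: measurable_cons; [exact: measurable_fst|exact: measurable_snd].
Qed.

(* The product of lebesgue_measure and m, transported along
   (x, t) |-> x :: t. *)
Definition cons_measure : set (Rtuple R n.+1) -> \bar R :=
  pushforward (lebesgue_measure \x m)%E cons_pair.

Let cons_measure0 : cons_measure set0 = 0%E.
Proof. by rewrite /cons_measure /pushforward preimage_set0 measure0. Qed.

Let cons_measure_ge0 A : (0 <= cons_measure A)%E.
Proof. by rewrite /cons_measure /pushforward; exact: measure_ge0. Qed.

Let cons_measure_sigma_additive : semi_sigma_additive cons_measure.
Proof.
move=> F mF tF mUF; rewrite /cons_measure /pushforward preimage_bigcup.
apply: measure_semi_sigma_additive.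
- by move=> i; rewrite -[X in measurable X]setTI; exact: measurable_cons_pair.
- apply/trivIsetP => /= i j _ _ ij; rewrite -preimage_setI.
  by move/trivIsetP : tF => /(_ _ _ _ _ ij) ->//; rewrite preimage_set0.
- by rewrite -preimage_bigcup -[X in measurable X]setTI;
    exact: measurable_cons_pair.
Qed.

HB.instance Definition _ := isMeasure.Build _ _ _ cons_measure
  cons_measure0 cons_measure_ge0 cons_measure_sigma_additive.

Let cons_measure_sigma_finite : sigma_finite setT cons_measure.
Proof.
have /sigma_finiteP[F [FT ndF Foo]] :=
  sigma_finiteT (@lebesgue_measure R : {sigma_finite_measure set _ -> \bar R}).
have /sigma_finiteP[G [GT ndG Goo]] := sigma_finiteT m.
pose g (t : Rtuple R n.+1) : measurableTypeR R * Rtuple R n :=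
  (tnth t ord0, [tuple of behead t]).
have mg : measurable_fun setT g.
  apply: measurable_fun_pair; first exact: measurable_tnth.
  exact: measurable_behead.
have gK : cancel cons_pair g.
  by move=> [x t]; rewrite /g/=; congr (_, _); apply/val_inj.
exists (fun k => g @^-1` (F k `*` G k)).
  rewrite -preimage_bigcup; apply/esym; rewrite -subTset => t _ /=.
  have [i _ Fi] : (\bigcup_i F i) (tnth t ord0) by rewrite -FT.
  have [j _ Gj] : (\bigcup_i G i) [tuple of behead t] by rewrite -GT.
  exists (maxn i j) => //; split => /=.
    by move: Fi; exact/subsetPset/ndF/leq_maxl.
  by move: Gj; exact/subsetPset/ndG/leq_maxr.
move=> k; have [mFk Fkoo] := Foo k; have [mGk Gkoo] := Goo k; split.
  by rewrite -[X in measurable X]setTI; apply: mg => //; exact: measurableX.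
rewrite /cons_measure /pushforward -comp_preimage.
rewrite (_ : g \o cons_pair = id); last exact/funext.
by rewrite preimage_id product_measure1E// lte_mul_pinfty// ge0_fin_numE.
Qed.

HB.instance Definition _ := Measure_isSigmaFinite.Build _ _ _ cons_measure
  cons_measure_sigma_finite.

End cons_measure.

Fixpoint lebesgue_measure_tuple (R : realType) (n : nat) :
    {sigma_finite_measure set (Rtuple R n) -> \bar R} :=
  match n with
  | 0 => \d_ [tuple]
  | n'.+1 => cons_measure (lebesgue_measure_tuple R n')
  end.

Lemma measurable_tuple_rect (R : realType) (n : nat)
    (A : 'I_n -> set (measurableTypeR R)) :
  (forall i, measurable (A i)) ->
  measurable [set t : Rtuple R n | forall i, A i (tnth t i)].
Proof.
move=> mA.
rewrite (_ : [set t | _] =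
    \bigcap_(i in [set: 'I_n]) ((fun t : Rtuple R n => tnth t i) @^-1` A i)).
  apply: fin_bigcap_measurable => // i _; rewrite -[X in measurable X]setTI.
  exact: measurable_tnth.
by apply/seteqP; split => [t tA i _|t tA i]; [exact: tA|exact: (tA i)].
Qed.

Lemma lebesgue_measure_tuple_rect (R : realType) (n : nat)
    (A : 'I_n -> set (measurableTypeR R)) :
  (forall i, measurable (A i)) ->
  lebesgue_measure_tuple R n [set t | forall i, A i (tnth t i)] =
  (\prod_(i < n) lebesgue_measure (A i))%E.
Proof.
elim: n => [|n IHn] in A * => mA.
  rewrite big_ord0 /= diracE.
  by rewrite mem_set// => -[].
rewrite big_ord_recl -(IHn (fun i => A (lift ord0 i)))//.
rewrite -product_measure1E//; last first.
  by apply: (measurable_tuple_rect (A := fun i => A (lift ord0 i))) => i.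
rewrite /= /cons_measure /pushforward; congr (_ _).
apply/seteqP; split => [[x t]/= tA|[x t]/= [xA tA] i].
  split; first exact: (tA ord0).
  by move=> i; have := tA (lift ord0 i); rewrite tnthS.
by case: (unliftP ord0 i) => [j ->|->]; [rewrite tnthS; exact: tA|exact: xA].
Qed.

Definition unit_cube (R : realType) (n : nat) : set (Rtuple R n) :=
  [set x | forall i, 0 <= tnth x i <= 1].
Arguments unit_cube : clear implicits.

Definition corner_box (R : realType) (n : nat) (x : Rtuple R n) :
    set (Rtuple R n) :=
  [set y | forall i, 0 <= tnth y i < tnth x i].

Section unit_cube_measure.
Variables (R : realType) (n : nat).

Let unit_cubeE : unit_cube R n =
  [set t | forall i : 'I_n, `[0, 1]%classic (tnth t i)].
Proof. by apply/seteqP; split => t /= h i; have := h i; rewrite in_itv. Qed.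

Lemma measurable_unit_cube : measurable (unit_cube R n).
Proof.
rewrite unit_cubeE.
by apply: (measurable_tuple_rect (A := fun=> `[0, 1]%classic)) => i.
Qed.

Definition unit_cube_measure : set (Rtuple R n) -> \bar R :=
  mrestr (lebesgue_measure_tuple R n) measurable_unit_cube.

HB.instance Definition _ := Measure.on unit_cube_measure.

Let unit_cube_measure_setT : unit_cube_measure setT = 1%E.
Proof.
rewrite /unit_cube_measure /mrestr setTI unit_cubeE.
rewrite (lebesgue_measure_tuple_rect (A := fun=> `[0, 1]%classic))//.
rewrite big1// => i _.
by rewrite lebesgue_measure_itv/= lte_fin ltr01 sube0.
Qed.

HB.instance Definition _ := Measure_isProbability.Build _ _ _
  unit_cube_measure unit_cube_measure_setT.

End unit_cube_measure.
Arguments unit_cube_measure : clear implicits.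

Section orlicz.
Context {R : realType}.

Definition young_function (psi : R -> R) : Prop :=
  [/\ forall x, psi (- x) = psi x,
      @convex_function R R^o setT psi,
      psi 0 = 0
    & forall x, x != 0 -> psi x != 0].

Definition orlicz_norm d (T : measurableType d) (P : probability T R)
    (psi : R -> R) (f : T -> R) : \bar R :=
  ereal_inf [set K%:E | K in
    [set K : R | 0 < K /\ ('E_P[fun x => psi (f x * K^-1)%R] <= 1)%E]].

Definition LlogL_young (alpha : R) (phi : R -> R) : Prop :=
  young_function phi /\
  exists M : R, forall x, M <= `|x| ->
    phi x = `|x| * ln (3 + `|x|) `^ alpha.

(* For alpha = 0 the space is L^1 with its usual norm, and phi plays no role. *)
Definition LlogL_norm d (T : measurableType d) (P : probability T R)
    (alpha : R) (phi : R -> R) (f : T -> R) : \bar R :=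
  if alpha == 0 then 'N[P]_1[EFin \o f]%E else orlicz_norm P phi f.

End orlicz.

Definition discrepancy (R : realType) (n : nat) (A : {fset Rtuple R n})
    (x : Rtuple R n) : R :=
  #|` [fset a in A | a \in corner_box x]%fset|%:R -
  #|` A|%:R * fine (lebesgue_measure_tuple R n (corner_box x)).

(* Main.v *)
Require Import Defs.
From mathcomp Require Import all_boot all_order all_algebra finmap.
From mathcomp Require Import all_classical all_reals all_analysis.
From mathcomp Require Import measurable_realfun.
From mathcomp Require Import complex ring lra zify.

Import Order.TTheory GRing.Theory Num.Theory.
Import numFieldNormedType.Exports.

Local Open Scope classical_set_scope.
Local Open Scope ring_scope.

(** The proof is by duality: it builds a function whose pairing with D_N is
    large although its moments grow so slowly that pairing with it is bounded on
    L(log L)^((d-2)/2).  Write q = d - 2, choose M comparable to log N, and put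
    n = (q+1) M, so that 2^n is comparable to N and at least 2 N.

    The Haar layers (Roth).  Let r be a vector of exponents with sum n, and cut
    the cube into the 2^n dyadic boxes with sides 2^-r_j.  At least half of them
    contain no point.  Against the Haar function h_B of an empty box B the
    counting part of D_N vanishes, and the volume part gives
    - N 4^-d |B|^2.  Hence f_r, minus the sum of the Haar functions of the empty
    boxes, satisfies <D_N, f_r> >= c ([pairing_haar_empty]).  Conversely any
    function bounded by 1 and odd under the exchange of the two halves of the
    dyadic intervals of level r_j, for each coordinate j, pairs with D_N to at
    most 2 N 2^-|r| ([pairing_le]), which decays when |r| exceeds n.

    The Riesz products (Halasz).  Fix the q exponents s of the middle
    coordinates.  The layers f_k with exponents (k, s, n - k - |s|), k < M, are
    combined into Gamma_s = Im prod_k (1 + i delta f_k), with delta a small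
    multiple of 1 / sqrt M.  It is bounded, and
      prod_k (1 + x_k) =
        1 + sum_l x_l + sum_(k < l) x_l x_k prod_(k < j < l) (1 + x_j)
    shows that, beyond the linear terms, Gamma_s is made of products
    f_l f_k Im prod_(k < j < l) (1 + i delta f_j) times delta^2; such a product
    is odd at the exponents (l, s, n - k - |s|), of sum n + (l - k).  The linear
    terms contribute delta M c, the others O(delta^2 M), and
    <D_N, Gamma_s> >= c sqrt M ([pairing_riesz]).

    The moments.  The product is an odd function of the layers after taking its
    imaginary part, so Gamma_s is odd at level s_i of each middle coordinate, and
    it does not depend on the finer digits there.  The sum S of the M^q functions
    Gamma_s is thus an iterated sum of martingale differences, one coordinate at
    a time, each coordinate costing a factor (2 k M)^k in the moment of order
    2 k: E S^(2k) <= ((2 k M)^q e)^k ([moment_test_function]).  After division by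
    M^(q/2) this is the growth dual to L(log L)^(q/2), and an explicit Young
    inequality ([young_LlogL]) bounds <D_N, S / M^(q/2)> / K by a constant when
    K >= ||D_N||; on the other side that pairing is at least c M^((q+1)/2).

    All functions built here are constant on the cells of the dyadic grid of mesh
    2^-(n+1).  They are therefore functions on a finite set, flipping a binary
    digit is an involution of that set, and D_N enters only through its integrals
    over cells, which are products of one-dimensional integrals by Tonelli. *)

(** * Moments of sums of martingale differences *)

(** The ratio of the two binomials is a quotient of products of odd numbers,
    (2k-1)!! / ((2j-1)!! (2k-2j-1)!!); after cancellation the numerator has j
    factors, each at most 2k. *)
Lemma leq_bin_double (k j : nat) : ('C(k.*2, j.*2) <= 'C(k, j) * k.*2 ^ j)%N.
Proof.
elim: j k => [k|j IH [|k]]; first by rewrite double0 !bin0.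
  by rewrite double0 doubleS !bin0n.
have h1 := mul_bin_diag k.*2.+2 j.*2.+1.
have h2 := mul_bin_diag k.*2.+1 j.*2.
have h3 := mul_bin_diag k.+1 j.
have h4 := IH k; rewrite !doubleS expnS.
have h5 : (k.*2 ^ j <= k.*2.+2 ^ j)%N.
  by case: (j) => [|i] //; rewrite leq_exp2r// -doubleS leq_double.
move: h1 h2 h3 h4 h5; rewrite /=.
move: ('C(k.*2.+2, j.*2.+2)) ('C(k.*2.+1, j.*2.+1)) ('C(k.*2, j.*2)) => c1 c2 c3.
move: ('C(k.+1, j.+1)) ('C(k, j)) (k.*2 ^ j)%N (k.*2.+2 ^ j)%N => b1 b2 x y.
move=> h1 h2 h3 h4 h5.
rewrite -(@leq_pmul2l (j.*2.+1 * j.*2.+2))//.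
have -> : (j.*2.+1 * j.*2.+2 * c1 = k.*2.+2 * k.*2.+1 * c3)%N.
  rewrite -mulnA -h1 mulnCA -h2; ring.
apply: (@leq_trans (k.*2.+2 * k.*2.+1 * (b2 * y))).
  by rewrite leq_mul2l (leq_trans h4) ?orbT// leq_mul2l h5 orbT.
have -> : (k.*2.+2 * k.*2.+1 * (b2 * y) = j.*2.+2 * k.*2.+1 * (b1 * y))%N.
  rewrite -!doubleS -!muln2 /= in h3 *.
  have : (2 * (k.*2.+1) * y * (k.+1 * b2) = 2 * (k.*2.+1) * y * (j.+1 * b1))%N.
    by rewrite h3.
  lia.
rewrite (_ : (j.*2.+1 * j.*2.+2 * (b1 * (k.*2.+2 * y)) =
  j.*2.+2 * k.*2.+2 * (b1 * y) * j.*2.+1)%N); last by ring.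
by apply: leq_trans (leq_pmulr _ _) => //; rewrite leq_mul2r leq_mul2l leqnSn !orbT.
Qed.

Lemma sum_exprD_exprB (R : realFieldType) (k : nat) (x z : R) :
  ((x + z) ^+ k.*2 + (x - z) ^+ k.*2) / 2 =
  \sum_(j < k.+1) (x ^+ 2) ^+ (k - j) * (z ^+ 2) ^+ j *+ 'C(k.*2, j.*2).
Proof.
have even_sum (G : nat -> R) m : (forall i, odd i -> G i = 0) ->
    \sum_(0 <= i < m.*2.+1) G i = \sum_(0 <= j < m.+1) G j.*2.
  move=> G0; elim: m => [|m IH]; first by rewrite !big_nat1.
  rewrite doubleS [LHS]big_nat_recr//= [X in X + _ = _]big_nat_recr//= IH.
  rewrite [RHS]big_nat_recr//= -addrA; congr (_ + _).
  by rewrite G0/= ?odd_double// add0r.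
pose G i := x ^+ (k.*2 - i) * z ^+ i *+ 'C(k.*2, i) * ((1 + (-1) ^+ i) / 2).
transitivity (\sum_(0 <= i < k.*2.+1) G i).
  rewrite exprDn exprBn -big_split/= mulr_suml big_mkord; apply: eq_bigr => i _.
  by rewrite /G -!mulrA -mulrnDl; ring.
rewrite even_sum => [|i oi]; last by rewrite /G -signr_odd oi/= expr1 subrr mul0r mulr0.
rewrite big_mkord; apply: eq_bigr => j _.
rewrite /G -signr_odd odd_double expr0 (_ : (1 + 1) / 2 = 1 :> R); last by field.
by rewrite mulr1 -!exprM -doubleB !mul2n.
Qed.

(** The two-point inequality behind the sub-Gaussian constant: a fair sign in
    front of z turns the power 2 k of x + z into a power k of x^2 + 2 k z^2. *)
Lemma ler_sum_exprD_exprB (R : realFieldType) (k : nat) (x z : R) :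
  ((x + z) ^+ k.*2 + (x - z) ^+ k.*2) / 2 <= (x ^+ 2 + k.*2%:R * z ^+ 2) ^+ k.
Proof.
rewrite sum_exprD_exprB exprDn; apply: ler_sum => j _.
move: (sqr_ge0 x) (sqr_ge0 z); move: (x ^+ 2) (z ^+ 2) => u v u0 v0.
rewrite exprMn -[leLHS]mulr_natr -[leRHS]mulr_natr.
have := exprn_ge0 (k - j) u0; have := exprn_ge0 j v0.
have : 'C(k.*2, j.*2)%:R <= 'C(k, j)%:R * k.*2%:R ^+ j :> R.
  by rewrite -natrX -natrM ler_nat leq_bin_double.
move: (u ^+ (k - j)) (v ^+ j) => X Z Ck Z0 X0.
rewrite [leRHS](_ : _ =
    X * Z * ('C(k, j)%:R * k.*2%:R ^+ j)); last by ring.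
by apply: ler_wpM2l => //; exact: mulr_ge0.
Qed.

(** Convexity of the power n+1 at the weights t / (t + 1) and 1 / (t + 1), with
    denominators cleared; it replaces the triangle inequality in L^(n+1) when
    the moments of x and y are known to grow like t^(n+1) and 1. *)
Lemma exprD_convex (R : realFieldType) (n : nat) (t x y : R) :
  0 <= t -> 0 <= x -> 0 <= y ->
  t ^+ n * (x + y) ^+ n.+1 <= (t + 1) ^+ n * (x ^+ n.+1 + t ^+ n * y ^+ n.+1).
Proof.
move=> t0 x0 y0; elim: n => [|n IH]; first by rewrite !expr0 !mul1r !expr1.
(* The difference of the two sides in the inductive step factors like this. *)
have h : 0 <= (x - t * y) * (x ^+ n.+1 - (t * y) ^+ n.+1).
  have ty : 0 <= t * y by exact: mulr_ge0.
  case: (leP x (t * y)) => xty.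
    by rewrite mulr_le0 ?subr_le0 ?lerXn2r.
  by rewrite mulr_ge0 ?subr_ge0 ?lerXn2r// ltW.
rewrite (_ : t ^+ n.+1 * _ = t * (x + y) * (t ^+ n * (x + y) ^+ n.+1)); last first.
  by rewrite !exprS; ring.
apply: le_trans (ler_wpM2l _ IH) _; first by rewrite mulr_ge0 ?addr_ge0.
rewrite [leRHS](_ : _ = (t + 1) ^+ n * ((t + 1) *
  (x ^+ n.+2 + t ^+ n.+1 * y ^+ n.+2))); last by rewrite [(t + 1) ^+ n.+1]exprS; ring.
rewrite [leLHS](_ : _ = (t + 1) ^+ n * (t * (x + y) *
  (x ^+ n.+1 + t ^+ n * y ^+ n.+1))); last by ring.
apply: ler_wpM2l; first by rewrite exprn_ge0// addr_ge0.
rewrite -subr_ge0; apply: le_trans h _; rewrite le_eqVlt; apply/orP; left; apply/eqP.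
by rewrite !exprMn !exprS; ring.
Qed.

Section moments.
Context {R : realFieldType} {T : finType}.
Implicit Types (F : T -> R).

Lemma sum_involutive (tau : T -> T) F : involutive tau ->
  \sum_x F (tau x) = \sum_x F x.
Proof. by move=> tauK; rewrite [RHS](reindex_inj (inv_inj tauK)). Qed.

(** A martingale difference sequence is encoded by involutions: X_t changes sign
    under the involution tau_t and is invariant under the later ones.  Averaging
    over tau_M replaces the last step of the sum by the two-point inequality. *)
Lemma moment_sum (k M : nat) (tau : nat -> T -> T) (X : nat -> T -> R) (a : R) :
  (forall t, involutive (tau t)) ->
  (forall t x, (t < M)%N -> X t (tau t x) = - X t x) ->
  (forall t u x, (t < u < M)%N -> X t (tau u x) = X t x) ->
  0 <= a ->
  (forall t, (t < M)%N -> \sum_x X t x ^+ k.+1.*2 <= a) ->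
  \sum_x (\sum_(t < M) X t x) ^+ k.+1.*2 <= (k.+1.*2 * M)%:R ^+ k.+1 * a.
Proof.
move=> tauK Xodd Xinv a0; elim: M => [|M IH] in Xodd Xinv * => Xa.
  rewrite muln0 expr0n mul0r big1// => x _.
  by rewrite big_ord0 expr0n.
have {}IH : \sum_x (\sum_(t < M) X t x) ^+ k.+1.*2 <= (k.+1.*2 * M)%:R ^+ k.+1 * a.
  apply: IH => [t x tM|t u x /andP[tu uM]|t tM]; last exact/Xa/ltnW.
    by apply: Xodd; apply: ltnW.
  by apply: Xinv; rewrite tu ltnW.
pose Y x := \sum_(t < M) X t x.
have YX x : \sum_(t < M.+1) X t x = Y x + X M x by rewrite big_ord_recr.
under eq_bigr do rewrite YX.
have -> : \sum_x (Y x + X M x) ^+ k.+1.*2 =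
    \sum_x ((Y x + X M x) ^+ k.+1.*2 + (Y x - X M x) ^+ k.+1.*2) / 2.
  rewrite -mulr_suml big_split/=.
  rewrite -[X in _ = (_ + X) / _](@sum_involutive (tau M))//.
  rewrite [X in _ = (_ + X) / _](_ : _ = \sum_x (Y x + X M x) ^+ k.+1.*2).
    by field.
  apply: eq_bigr => x _; rewrite Xodd// opprK; congr ((_ + _) ^+ _).
  by apply: eq_bigr => t _; rewrite Xinv// ltnSn andbT.
apply: (@le_trans _ _ (\sum_x (Y x ^+ 2 + k.+1.*2%:R * X M x ^+ 2) ^+ k.+1)).
  by apply: ler_sum => x _; exact: ler_sum_exprD_exprB.
have [M0|M0] := posnP M.
  under eq_bigr do rewrite /Y [in X in X ^+ 2 + _]M0 big_ord0 expr0n/= add0r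
    exprMn -exprM mul2n.
  by rewrite -mulr_sumr [in leRHS]M0 muln1 ler_wpM2l ?exprn_ge0// Xa.
have MR : (0 : R) < M%:R by rewrite ltr0n.
rewrite -(ler_pM2l (exprn_gt0 k MR)) mulr_sumr.
apply: (@le_trans _ _ (\sum_x (M%:R + 1) ^+ k * ((Y x ^+ 2) ^+ k.+1 +
    M%:R ^+ k * (k.+1.*2%:R * X M x ^+ 2) ^+ k.+1))).
  apply: ler_sum => x _; apply: exprD_convex => //; first exact: sqr_ge0.
  by rewrite mulr_ge0 ?sqr_ge0.
rewrite -mulr_sumr big_split/= -mulr_sumr.
under eq_bigr do rewrite -exprM mul2n.
under [X in _ * (_ + _ * X)]eq_bigr do rewrite exprMn -exprM mul2n.
rewrite -mulr_sumr.
have h : \sum_x (Y x) ^+ k.+1.*2 + M%:R ^+ k * (k.+1.*2%:R ^+ k.+1 * \sum_x X M x ^+ k.+1.*2) <=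
   M%:R ^+ k * k.+1.*2%:R ^+ k.+1 * a * (M%:R + 1).
  rewrite mulrDr mulr1 lerD//.
    apply: le_trans IH _; rewrite natrM exprMn [M%:R ^+ _ in leLHS]exprS.
    by rewrite le_eqVlt; apply/orP; left; apply/eqP; ring.
  by rewrite -mulrA ler_wpM2l ?exprn_ge0// ler_wpM2l ?exprn_ge0// Xa.
apply: le_trans (ler_wpM2l _ h) _; first by rewrite exprn_ge0// addr_ge0.
rewrite natrM exprMn -[M.+1%:R]natr1 [(M%:R + 1) ^+ k.+1]exprS.
by rewrite le_eqVlt; apply/orP; left; apply/eqP; ring.
Qed.

End moments.
Lemma sum_tupleS (V : nmodType) (I : finType) (p : nat) (F : p.+1.-tuple I -> V) :
  \sum_s F s = \sum_t \sum_(s : p.-tuple I) F (cons_tuple t s).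
Proof.
rewrite pair_bigA/= (reindex (fun u : I * p.-tuple I => cons_tuple u.1 u.2))//=.
exists (fun s : p.+1.-tuple I => (thead s, behead_tuple s)) => [[t s] _|s _] /=.
  by rewrite theadE; congr (_, _); apply: val_inj.
by apply: val_inj; case/tupleP: s => t s; rewrite /= theadE.
Qed.

(** The sum over a tuple of indices is a martingale sum in its first index, with
    increments that are sums over the remaining indices; iterating
    [moment_sum] multiplies the constants. *)
Lemma moment_sum_tuple (R : realFieldType) (T : finType) (k M p : nat)
    (tau : nat -> nat -> T -> T) (F : p.-tuple 'I_M -> T -> R) (a : R) :
  (forall i t, involutive (tau i t)) ->
  (forall (s : p.-tuple 'I_M) x (i : 'I_p), F s (tau i (tnth s i) x) = - F s x) ->
  (forall (s : p.-tuple 'I_M) x (i : 'I_p) u, (tnth s i < u < M)%N -> F s (tau i u x) = F s x) ->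
  0 <= a ->
  (forall s, \sum_x F s x ^+ k.+1.*2 <= a) ->
  \sum_x (\sum_s F s x) ^+ k.+1.*2 <= (k.+1.*2 * M)%:R ^+ (k.+1 * p) * a.
Proof.
move=> tauK Fodd Finv a0 Fa; elim: p => [|p IH] in tau tauK F Fodd Finv Fa *.
  rewrite muln0 expr0 mul1r; apply: le_trans (Fa [tuple]).
  apply: ler_sum => x _; rewrite (big_pred1 [tuple])// => s.
  by apply/esym/eqP; exact: tuple0.
under eq_bigr do rewrite sum_tupleS.
pose X t x := if insub t is Some t' then
  \sum_(s : p.-tuple 'I_M) F (cons_tuple t' s) x else 0.
have XE (t : 'I_M) x : X t x = \sum_(s : p.-tuple 'I_M) F (cons_tuple t s) x.
  by rewrite /X valK.
under eq_bigr do under eq_bigr do rewrite -XE.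
rewrite mulnS exprD -mulrA.
apply: (moment_sum k M (tau 0%N)) => [t|t x tM|t u x tuM||t tM].
- exact: tauK.
- rewrite !(XE (Ordinal tM)) -sumrN; apply: eq_bigr => s _.
  by rewrite -(Fodd _ _ ord0).
- have tM : (t < M)%N by case/andP: tuM => tu; apply: ltn_trans.
  rewrite !(XE (Ordinal tM)); apply: eq_bigr => s _.
  by rewrite -[RHS](Finv _ _ ord0 u)// tnth0.
- by rewrite mulr_ge0// exprn_ge0.
- under eq_bigr do rewrite (XE (Ordinal tM)).
  apply: (IH (fun i => tau i.+1)) => [i u|s x i|s x i u|s].
  + exact: tauK.
  + by rewrite -(Fodd _ _ (lift ord0 i)) tnthS.
  + by move=> h; rewrite -[RHS](Finv _ _ (lift ord0 i) u)// tnthS.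
  + exact: Fa.
Qed.
(** * Riesz products *)

Section riesz_product.
Context {R : rcfType}.
Implicit Types (y : nat -> R) (k l : nat).
Local Open Scope complex_scope.

(** Telescoping the product from the right isolates its last factor x_l, and
    telescoping what precedes it from the left isolates the first factor x_k. *)
Lemma prod_add1_expansion (A : comPzRingType) (x : nat -> A) (M : nat) :
  \prod_(0 <= j < M) (1 + x j) = 1 + \sum_(0 <= l < M) x l +
    \sum_(0 <= l < M) \sum_(0 <= k < l) x l * x k * \prod_(k.+1 <= j < l) (1 + x j).
Proof.
have one_sided (l : nat) : \prod_(0 <= j < l) (1 + x j) =
    1 + \sum_(0 <= k < l) x k * \prod_(k.+1 <= j < l) (1 + x j).
  elim: l => [|l IH]; first by rewrite !big_nil addr0.
  rewrite big_nat_recr//= big_nat_recr//= [X in _ = 1 + (_ + _ * X)]big_geq// mulr1.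
  under [X in 1 + (X + _)]eq_big_nat => k /andP[_ kl].
    rewrite big_nat_recr//= mulrA; over.
  by rewrite -mulr_suml IH; ring.
elim: M => [|M IH]; first by rewrite !big_nil !addr0.
rewrite big_nat_recr//= [X in _ = 1 + X + _]big_nat_recr//=.
rewrite [X in _ = _ + X]big_nat_recr//= mulrDr mulr1 {1}IH one_sided.
rewrite mulrDl mul1r mulr_suml.
under [X in _ = _ + (_ + X)]eq_bigr do rewrite -mulrA mulrC.
ring.
Qed.

Definition riesz y k l : R[i] := \prod_(k <= j < l) (1 +i* y j).

Lemma Im_rieszE y (M : nat) : complex.Im (riesz y 0 M) =
  \sum_(0 <= l < M) y l -
  \sum_(0 <= l < M) \sum_(0 <= k < l) y l * y k * complex.Im (riesz y k.+1 l).
Proof.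
have E k l : riesz y k l = \prod_(k <= j < l) (1 + 0 +i* y j).
  by apply: eq_bigr => j _; apply/eqP; rewrite eq_complex/= addr0 add0r !eqxx.
rewrite E prod_add1_expansion !raddfD !raddf_sum/= add0r; congr (_ + _).
rewrite -?sumrN; apply: eq_bigr => l _; rewrite raddf_sum -sumrN.
apply: eq_bigr => k _; rewrite -E; case: (riesz y k.+1 l) => a b /=.
ring.
Qed.

(** The modulus of 1 + i y is sqrt (1 + y^2): for M factors with y of order
    1 / sqrt M the product stays bounded. *)
Lemma sqr_riesz y k l : complex.Re (riesz y k l) ^+ 2 + complex.Im (riesz y k l) ^+ 2 =
  \prod_(k <= j < l) (1 + y j ^+ 2).
Proof.
apply: (big_rec2 (fun (z : R[i]) (r : R) => complex.Re z ^+ 2 + complex.Im z ^+ 2 = r)).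
  by rewrite /= expr0n/= expr1n addr0.
move=> j [a b] r _ /= <-; ring.
Qed.

(** Changing all signs conjugates the product. *)
Lemma Im_riesz_opp y k l : complex.Im (riesz (fun j => - y j) k l) = - complex.Im (riesz y k l).
Proof.
have [//] : complex.Im (riesz (fun j => - y j) k l) = - complex.Im (riesz y k l) /\
  complex.Re (riesz (fun j => - y j) k l) = complex.Re (riesz y k l).
apply: (big_rec2 (fun (z w : R[i]) => complex.Im z = - complex.Im w /\
  complex.Re z = complex.Re w)); first by rewrite /= oppr0.
by move=> j [a b] [c d] _ /= [-> ->]; split; ring.
Qed.

End riesz_product.
(** * Binary digits and dyadic blocks *)

(** Exchange of the two halves of the block of length 2^(e+1) containing w, that
    is, flipping the binary digit of weight 2^e. *)
Definition flip_nat (e w : nat) : nat :=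
  if odd (w %/ 2 ^ e) then (w - 2 ^ e)%N else (w + 2 ^ e)%N.

Lemma flip_nat_divn (e w : nat) : (flip_nat e w %/ 2 ^ e =
  if odd (w %/ 2 ^ e) then (w %/ 2 ^ e).-1 else (w %/ 2 ^ e).+1)%N.
Proof.
have e0 : (0 < 2 ^ e)%N by rewrite expn_gt0.
rewrite /flip_nat; case: ifPn => we; last by rewrite divnDr ?dvdnn// divnn e0 addn1.
by rewrite -{1}(mul1n (2 ^ e)%N) divnBMl subn1.
Qed.

Lemma flip_natK (e : nat) : involutive (flip_nat e).
Proof.
move=> w; rewrite [LHS]/flip_nat flip_nat_divn /flip_nat.
have [we|we] := boolP (odd (w %/ 2 ^ e)); last by rewrite /= we addnK.
have we0 : (0 < w %/ 2 ^ e)%N by case: (w %/ _)%N we.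
rewrite ifF; last by apply/negbTE; rewrite -oddS prednK.
by rewrite subnK//; move: we0; rewrite divn_gt0// expn_gt0.
Qed.

Lemma flip_nat_divn_gt (e e' w : nat) : (e < e')%N ->
  (flip_nat e w %/ 2 ^ e' = w %/ 2 ^ e')%N.
Proof.
move=> /subnKC <-; rewrite addSnnS expnD expnS !divnMA flip_nat_divn.
congr (_ %/ _)%N; move: (w %/ 2 ^ e)%N => b.
by rewrite !divn2; case: ifPn => bo; lia.
Qed.

Section dyadic_digits.
Context {n : nat}.
Implicit Types (r : nat) (w : 'I_(2 ^ n.+1)).

(** Digits are numbered from the most significant one, so that digit r decides
    between the halves of the dyadic intervals of length 2^-r.  The default value
    of [insubd] is never reached ([val_flip_digit]); it makes the map total. *)
Definition flip_digit r w : 'I_(2 ^ n.+1) := insubd w (flip_nat (n - r) w).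

(** The number formed by the first r digits of w: the position of the dyadic
    interval of length 2^-r that contains the cell of w. *)
Definition dyadic_block r w : nat := (w %/ 2 ^ (n - r).+1)%N.

(** Flipping a digit keeps the quotient by 2^(n+1), which is 0. *)
Lemma val_flip_digit r w : val (flip_digit r w) = flip_nat (n - r) w.
Proof.
rewrite /flip_digit val_insubd; case: ifPn => //.
have : (w %/ 2 ^ n.+1 = 0)%N by rewrite divn_small.
rewrite -(@flip_nat_divn_gt (n - r)) ?ltnS ?leq_subr// => h0.
by rewrite (divn_eq (flip_nat (n - r) w) (2 ^ n.+1)) h0 add0n ltn_mod expn_gt0.
Qed.

Lemma flip_digitK r : involutive (flip_digit r).
Proof. by move=> w; apply: val_inj; rewrite !val_flip_digit flip_natK. Qed.

Lemma dyadic_block_flip r r' w : (r <= r')%N -> dyadic_block r (flip_digit r' w) = dyadic_block r w.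
Proof. by move=> rr'; rewrite /dyadic_block val_flip_digit flip_nat_divn_gt// ltnS leq_sub2l. Qed.

Definition rademacher {R : pzRingType} r w : R :=
  if odd (w %/ 2 ^ (n - r)) then 1 else -1.

Lemma rademacher_flip (R : pzRingType) r w :
  rademacher r (flip_digit r w) = - rademacher r w :> R.
Proof.
rewrite /rademacher val_flip_digit flip_nat_divn.
case: (w %/ _)%N => [|b] /=; first by rewrite opprK.
by case: (boolP (odd b)) => /= bo; rewrite ?bo ?(negbTE bo) ?opprK.
Qed.

Lemma rademacher_flip_gt (R : pzRingType) r r' w : (r < r' <= n)%N ->
  rademacher r (flip_digit r' w) = rademacher r w :> R.
Proof.
move=> /andP[rr' r'n]; rewrite /rademacher val_flip_digit flip_nat_divn_gt//.
by rewrite ltn_sub2l// (leq_trans rr').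
Qed.

Lemma sqr_rademacher (R : pzRingType) r w : rademacher r w * rademacher r w = 1 :> R.
Proof. by rewrite /rademacher; case: ifP; rewrite ?mulrNN mulr1. Qed.

Lemma card_dyadic_block r (b : nat) : (r <= n)%N ->
  (#|[pred w | dyadic_block r w == b]| <= 2 ^ (n - r).+1)%N.
Proof.
move=> rn; set c := (2 ^ (n - r).+1)%N.
have c0 : (0 < c)%N by rewrite expn_gt0.
pose f w := Ordinal (ltn_pmod w c0).
rewrite -[leqRHS](card_ord c) -(card_in_imset (f := f)) ?max_card//.
move=> w w' /eqP; rewrite inE => wb /eqP w'b /(congr1 val)/= ww'.
apply: val_inj => /=; rewrite (divn_eq w c) (divn_eq w' c) ww'.
by move: wb w'b; rewrite /dyadic_block -/c => -> ->.
Qed.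

End dyadic_digits.
(** * Cells of the real line *)

Section dyadic_cells.
Context {R : realType} {n : nat}.
Implicit Types (r : nat) (w : 'I_(2 ^ n.+1)) (a : R).

Definition mesh : R := 2 ^- n.+1.

Lemma mesh_gt0 : 0 < mesh.
Proof. by rewrite invr_gt0 exprn_gt0. Qed.

Lemma mesh_exp r : (r <= n)%N -> 2 ^+ (n - r).+1 * mesh = 2 ^- r.
Proof.
move=> rn; rewrite /mesh -[in 2 ^- n.+1](subnK rn) -addSn exprD invfM mulrA.
by rewrite divff ?mul1r// expf_neq0.
Qed.

Definition cell w : set R := `[w%:R * mesh, w.+1%:R * mesh[%classic.

Lemma lebesgue_measure_cell w : lebesgue_measure (cell w) = mesh%:E.
Proof.
rewrite lebesgue_measure_itv/= lte_fin ltr_pM2r ?mesh_gt0// ltr_nat ltnSn.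
by rewrite -EFinB -mulrBl -natrB// subSnn mul1r.
Qed.

(** The integral over the cell of the indicator function of a < x. *)
Definition cell_above a w : R := fine (lebesgue_measure (cell w `&` `]a, +oo[)).

Lemma measurable_cell_above a w : measurable (cell w `&` `]a, +oo[).
Proof. by apply: measurableI; exact: measurable_itv. Qed.

Lemma lebesgue_measure_cell_above a w :
  lebesgue_measure (cell w `&` `]a, +oo[) = (cell_above a w)%:E.
Proof.
rewrite fineK// ge0_fin_numE ?measure_ge0//.
apply: (@le_lt_trans _ _ (lebesgue_measure (cell w))); last first.
  by rewrite lebesgue_measure_cell ltry.
apply: le_measure; rewrite ?inE; last exact: subIsetl.
  exact: measurable_cell_above.
exact: measurable_itv.
Qed.

Lemma cell_above_ge0 a w : 0 <= cell_above a w.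
Proof. by rewrite fine_ge0. Qed.

Lemma cell_above_le a w : cell_above a w <= mesh.
Proof.
rewrite -lee_fin -lebesgue_measure_cell_above -(lebesgue_measure_cell w).
apply: le_measure; rewrite ?inE; last exact: subIsetl.
  exact: measurable_cell_above.
exact: measurable_itv.
Qed.

(** The integral of x over the cell, as [integral_cell_id] shows. *)
Definition cell_integral w : R := (w%:R + 1 / 2) * mesh ^+ 2.

Definition in_block r a w := (dyadic_block r w)%:R <= 2 ^+ r * a < (dyadic_block r w).+1%:R.

Lemma cell_block r w : (r <= n)%N ->
  (dyadic_block r w)%:R * 2 ^- r <= w%:R * mesh /\
  w.+1%:R * mesh <= (dyadic_block r w).+1%:R * 2 ^- r.
Proof.
move=> rn; rewrite -(mesh_exp _ rn) !mulrA !ler_pM2r ?mesh_gt0//.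
rewrite -natrX -!natrM !ler_nat; split; first exact: leq_divM.
by rewrite ltn_ceil// expn_gt0.
Qed.


(** The indicator of a < x is constant on a dyadic interval that does not contain
    a, hence so is its integral over the cells of that interval. *)
Lemma cell_above_flip r a w : (r <= n)%N -> ~~ in_block r a w ->
  cell_above a (flip_digit r w) = cell_above a w.
Proof.
move=> rn; rewrite negb_and -leNgt -ltNge => aw.
have r0 : (0 : R) < 2 ^+ r by rewrite exprn_gt0.
have [c1 c2] := cell_block _ w rn; have [d1 d2] := cell_block _ (flip_digit r w) rn.
have ww' : dyadic_block r (flip_digit r w) = dyadic_block r w by exact: dyadic_block_flip.
rewrite ww' in d1 d2.
have above w' : (dyadic_block r w)%:R * 2 ^- r <= w'%:R * mesh ->
    2 ^+ r * a < (dyadic_block r w)%:R ->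
    cell_above a w' = mesh.
  move=> h1 h2; rewrite /cell_above setIidl ?lebesgue_measure_cell//.
  move=> x; rewrite /cell/= !in_itv/= andbT => /andP[h3 _].
    apply: lt_le_trans h3; apply: lt_le_trans h1.
  by rewrite ltr_pdivlMr// mulrC.
have below w' : w'.+1%:R * mesh <= (dyadic_block r w).+1%:R * 2 ^- r ->
    (dyadic_block r w).+1%:R <= 2 ^+ r * a ->
    cell_above a w' = 0.
  move=> h1 h2; rewrite /cell_above (_ : _ `&` _ = set0) ?measure0//.
  apply/seteqP; split => x //; rewrite /cell/= !in_itv/= andbT => -[/andP[_ h3]].
  apply/negP; rewrite -leNgt; apply: le_trans (ltW h3) _; apply: le_trans h1 _.
  by rewrite ler_pdivrMr// mulrC.
by case/orP: aw => aw; [rewrite !above|rewrite !below].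
Qed.

Lemma cell_integral_flip r w : (r <= n)%N ->
  cell_integral w - cell_integral (flip_digit r w) = rademacher r w * (mesh * 2 ^- r / 2).
Proof.
move=> rn; rewrite -mesh_exp// /cell_integral /rademacher val_flip_digit /flip_nat.
case: ifPn => wr; rewrite [2 ^+ (n - r).+1]exprS -natrX.
  rewrite natrB; last first.
    by rewrite -divn_gt0 ?expn_gt0//; case: (_ %/ _)%N wr.
  by field.
by rewrite natrD; field.
Qed.

(** A point lies in at most one dyadic interval of length 2^-r. *)
Lemma sum_in_block r a : (r <= n)%N ->
  \sum_w (in_block r a w)%:R * mesh <= 2 ^- r.
Proof.
move=> rn; rewrite -mulr_suml -mesh_exp// ler_pM2r ?mesh_gt0//.
rewrite -natrX -natr_sum ler_nat -big_mkcond/= sum1_card.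
have [[w0 w0a]|noa] := pselect (exists w, in_block r a w); last first.
  by rewrite eq_card0// => w; rewrite inE; apply/negP => wa; apply: noa; exists w.
apply: leq_trans (card_dyadic_block r (dyadic_block r w0) rn).
apply: subset_leq_card; apply/fintype.subsetP => w; rewrite !inE => wa.
case/andP: wa => h1 h2; case/andP: w0a => h3 h4.
have := le_lt_trans h1 h4; have := le_lt_trans h3 h2.
by rewrite !ltr_nat !ltnS => ? ?; rewrite eqn_leq; apply/andP.
Qed.

End dyadic_cells.
Arguments mesh R n : clear implicits.
(** * Pairing the discrepancy with Haar-odd functions *)

Section dyadic_grid.
Context {R : realType} {n d : nat}.
Local Notation grid := {ffun 'I_d -> 'I_(2 ^ n.+1)}.
Implicit Types (r : 'I_d -> nat) (F : grid -> R) (A : seq (d.-tuple R)).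

Definition flip_at (j : 'I_d) (t : nat) (w : grid) : grid :=
  [ffun i => if i == j then flip_digit t (w i) else w i].

Lemma flip_atK j t : involutive (flip_at j t).
Proof.
move=> w; apply/ffunP => i; rewrite !ffunE.
by case: (i == j) => //; exact: flip_digitK.
Qed.

(** The basic example is the product of the Haar functions of level r j in each
    coordinate j, times any function of the coarser digits. *)
Definition haar_odd r F := forall j w, F (flip_at j (r j) w) = - F w.

(** Against an odd function only the odd part of each factor survives.  The
    coordinates are antisymmetrised one after the other. *)
Lemma sum_haar_odd r F (v : 'I_d -> 'I_(2 ^ n.+1) -> R) : haar_odd r F ->
  \sum_w F w * \prod_j v j (w j) =
  \sum_w F w * \prod_j ((v j (w j) - v j (flip_digit (r j) (w j))) / 2).
Proof.
move=> Fodd.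
(* The integrand when the first m coordinates have been treated. *)
pose v' m (j : 'I_d) x := if (j < m)%N then (v j x - v j (flip_digit (r j) x)) / 2 else v j x.
have main m : (m <= d)%N -> \sum_w F w * \prod_j v j (w j) =
    \sum_w F w * \prod_j v' m j (w j).
  elim: m => [_|m IH md]; first by [].
  rewrite IH; last exact: ltnW.
  pose i := Ordinal md.
  pose W (w : grid) := \prod_(j | j != i) v' m j (w j).
  have WE m' (w : grid) : (m' = m \/ m' = m.+1) -> \prod_j v' m' j (w j) = v' m' i (w i) * W w.
    move=> mm'; rewrite (bigD1 i)//=; congr (_ * _); apply: eq_bigr => j ji.
    rewrite /v'; case: mm' => -> //.
    by rewrite ltnS leq_eqVlt -[m]/(val i) (inj_eq val_inj) (negbTE ji).
  under eq_bigr do rewrite (WE m _ (or_introl erefl)).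
  under [RHS]eq_bigr do rewrite (WE m.+1 _ (or_intror erefl)).
  have -> : \sum_w F w * (v' m.+1 i (w i) * W w) =
      (\sum_w F w * (v i (w i) * W w) + \sum_w (- F w) * (v i (flip_digit (r i) (w i)) * W w)) / 2.
    rewrite -big_split mulr_suml; apply: eq_bigr => w _.
    by rewrite /v' /= ltnSn; ring.
  rewrite -[X in _ = (_ + X) / 2](sum_involutive (flip_at i (r i))); last exact: flip_atK.
  rewrite [X in _ = (_ + X) / 2](_ : _ = \sum_w F w * (v i (w i) * W w)); last first.
    apply: eq_bigr => w _; rewrite Fodd opprK ffunE eqxx flip_digitK; congr (_ * (_ * _)).
    by apply: eq_bigr => j ji; rewrite ffunE (negbTE ji).
  by rewrite /v' /= ltnn; field.
rewrite (main d)//; apply: eq_bigr => w _; congr (_ * _); apply: eq_bigr => j _.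
by rewrite /v' ltn_ord.
Qed.

Lemma sum_prod_grid (G : 'I_d -> 'I_(2 ^ n.+1) -> R) :
  \sum_(w : grid) \prod_j G j (w j) = \prod_j \sum_x G j x.
Proof. by rewrite bigA_distr_bigA. Qed.

(** The integral of the discrepancy function over the product of the cells w j
    ([integral_discrepancy_box]). *)
Definition cell_discrepancy A (w : grid) : R :=
  \sum_(a <- A) \prod_j cell_above (tnth a j) (w j) -
  (size A)%:R * \prod_j cell_integral (w j).

Definition pairing A F : R := \sum_w F w * cell_discrepancy A w.

Lemma pairingE A F : pairing A F =
  \sum_(a <- A) (\sum_w F w * \prod_j cell_above (tnth a j) (w j)) -
  (size A)%:R * \sum_w F w * \prod_j cell_integral (w j).
Proof.
rewrite exchange_big/= mulr_sumr -sumrB; apply: eq_bigr => w _.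
by rewrite mulrBr mulr_sumr mulrCA.
Qed.

(** The odd part of the counting function is supported on the dyadic interval of
    the point. *)
Lemma fold_above_le t a (x : 'I_(2 ^ n.+1)) : (t <= n)%N ->
  `|(cell_above a x - cell_above a (flip_digit t x)) / 2| <=
  (in_block t a x)%:R * mesh R n.
Proof.
move=> tn; have [_|xa] := boolP (in_block t a x); last first.
  by rewrite cell_above_flip// subrr mul0r normr0 mul0r.
have := cell_above_ge0 a x; have := cell_above_le a x.
have := cell_above_ge0 a (flip_digit t x); have := cell_above_le a (flip_digit t x).
rewrite mul1r ler_norml; lra.
Qed.

Lemma fold_integralE t (x : 'I_(2 ^ n.+1)) : (t <= n)%N ->
  (cell_integral x - cell_integral (flip_digit t x)) / 2 =
  rademacher t x * (mesh R n * 2 ^- t / 4).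
Proof. by move=> tn; rewrite cell_integral_flip//; field. Qed.

Lemma normr_rademacher t (x : 'I_(2 ^ n.+1)) : `|rademacher t x : R| = 1.
Proof. by rewrite /rademacher; case: ifP; rewrite ?normrN normr1. Qed.

Lemma sum_in_box r (a : d.-tuple R) : (forall j, r j <= n)%N ->
  \sum_(w : grid) \prod_j ((in_block (r j) (tnth a j) (w j))%:R * mesh R n) <=
  \prod_j 2 ^- r j.
Proof.
move=> rn; rewrite (sum_prod_grid (fun j x => (in_block (r j) (tnth a j) x)%:R * mesh R n)).
apply: ler_prod => j _; rewrite sum_in_block// andbT.
by apply: sumr_ge0 => x _; rewrite mulr_ge0// ltW// mesh_gt0.
Qed.

Lemma sum_mesh (c : 'I_d -> R) :
  \sum_(w : grid) \prod_j (mesh R n * c j) = \prod_j c j.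
Proof.
rewrite (sum_prod_grid (fun j x => mesh R n * c j)); apply: eq_bigr => j _.
rewrite sumr_const card_ord -mulr_natl natrX mulrA divff ?mul1r//.
Qed.

Lemma sum_mesh1 : \sum_(w : grid) mesh R n ^+ d = 1.
Proof.
transitivity (\prod_(j < d) (1 : R)); last by rewrite big1.
rewrite -(sum_mesh (fun=> 1)).
by apply: eq_bigr => w _; rewrite prodr_const card_ord mulr1.
Qed.

(** The decay in |r| has two sources: a point of A is seen only from the dyadic
    box that contains it, and the odd part of x on an interval of length 2^-t is
    of size 2^-t. *)
Lemma pairing_le A F r (b : R) : (forall j, r j <= n)%N -> haar_odd r F ->
  (forall w, `|F w| <= b) ->
  `|pairing A F| <= 2 * b * (size A)%:R * \prod_j 2 ^- r j.
Proof.
move=> rn Fodd Fb.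
have w0 : (0 < 2 ^ n.+1)%N by rewrite expn_gt0.
have b0 : 0 <= b by apply: le_trans (Fb [ffun=> Ordinal w0]).
have bound (v : 'I_d -> 'I_(2 ^ n.+1) -> R) (u : 'I_d -> 'I_(2 ^ n.+1) -> R) :
    (forall j x, `|(v j x - v j (flip_digit (r j) x)) / 2| <= u j x) ->
    \sum_(w : grid) \prod_j u j (w j) <= \prod_j 2 ^- r j ->
    `|\sum_w F w * \prod_j v j (w j)| <= b * \prod_j 2 ^- r j.
  move=> vu u2; rewrite (sum_haar_odd _ _ _ Fodd).
  apply: le_trans (ler_norm_sum _ _ _) _; apply: le_trans (ler_wpM2l b0 u2).
  rewrite mulr_sumr; apply: ler_sum => w _; rewrite normrM ler_pM//.
  rewrite normr_prod; apply: ler_prod => j _; rewrite normr_ge0/=; exact: vu.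
rewrite pairingE; apply: le_trans (ler_normB _ _) _.
rewrite [leRHS](_ : _ = (size A)%:R * (b * \prod_j 2 ^- r j) +
  (size A)%:R * (b * \prod_j 2 ^- r j)); last by ring.
apply: lerD.
  apply: le_trans (ler_norm_sum _ _ _) _.
  rewrite -sum1_size natr_sum mulr_suml; apply: ler_sum => a _; rewrite mul1r.
  apply: (bound (fun j => cell_above (tnth a j))
    (fun j x => (in_block (r j) (tnth a j) x)%:R * mesh R n)).
    by move=> j x; apply: fold_above_le.
  exact: sum_in_box.
rewrite normrM ger0_norm// ler_wpM2l//.
apply: (bound (fun=> cell_integral) (fun j x => mesh R n * 2 ^- r j)); last by rewrite sum_mesh.
move=> j x; rewrite fold_integralE// normrM normr_rademacher mul1r ger0_norm.
  by rewrite ler_pdivrMr// ler_peMr ?mulr_ge0 ?invr_ge0 ?exprn_ge0// ?ltW ?mesh_gt0//; lra.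
by rewrite !mulr_ge0 ?invr_ge0 ?exprn_ge0// ltW// mesh_gt0.
Qed.

(** The dyadic box with sides 2^-(r j) containing the cell w has no point of A. *)
Definition empty_box A r (w : grid) : bool :=
  all (fun a : d.-tuple R => ~~ [forall j, in_block (r j) (tnth a j) (w j)]) A.

(** The sign makes the pairing with the volume term - N x_1 ... x_d positive. *)
Definition haar_empty A r (w : grid) : R :=
  - ((empty_box A r w)%:R * \prod_j rademacher (r j) (w j)).

Lemma empty_box_flip A r j t w : (r j <= t)%N ->
  empty_box A r (flip_at j t w) = empty_box A r w.
Proof.
move=> rt; apply: eq_all => a; congr (~~ _); apply: eq_forallb => i.
rewrite ffunE; case: eqP => // ij; subst i.
by rewrite /in_block dyadic_block_flip.
Qed.

Lemma prod_flip_at (j : 'I_d) t w (v : 'I_d -> 'I_(2 ^ n.+1) -> R) :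
  \prod_i v i (flip_at j t w i) = v j (flip_digit t (w j)) * \prod_(i | i != j) v i (w i).
Proof.
rewrite (bigD1 j)//= ffunE eqxx; congr (_ * _).
by apply: eq_bigr => i ij; rewrite ffunE (negbTE ij).
Qed.

Lemma haar_empty_odd A r : haar_odd r (haar_empty A r).
Proof.
move=> j w; rewrite /haar_empty empty_box_flip//.
rewrite (prod_flip_at _ _ _ (fun i => rademacher (r i))) rademacher_flip.
by rewrite [in RHS](bigD1 j)//= mulNr mulrN opprK.
Qed.

Lemma haar_empty_inv A r j t w : (r j < t <= n)%N ->
  haar_empty A r (flip_at j t w) = haar_empty A r w.
Proof.
move=> /[dup] rtn /andP[rt _].
rewrite /haar_empty empty_box_flip ?(ltnW rt)//.
rewrite (prod_flip_at _ _ _ (fun i => rademacher (r i))) rademacher_flip_gt//.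
by rewrite [in RHS](bigD1 j).
Qed.

Lemma haar_empty_le1 A r w : `|haar_empty A r w| <= 1.
Proof.
rewrite normrN normrM normr_prod big1 ?mulr1 => [|j _]; last exact: normr_rademacher.
by case: (empty_box A r w); rewrite ?normr1 ?normr0.
Qed.

(** Each point spoils one box of volume 2^-|r|. *)
Lemma sum_empty_box A r : (forall j, r j <= n)%N ->
  1 - (size A)%:R * \prod_j 2 ^- r j <=
  \sum_(w : grid) (empty_box A r w)%:R * mesh R n ^+ d.
Proof.
move=> rn.
rewrite -[X in X - _ <= _]sum_mesh1.
apply: le_trans (_ : _ <= \sum_(w : grid) mesh R n ^+ d - \sum_(a <- A) \sum_(w : grid)
    \prod_j ((in_block (r j) (tnth a j) (w j))%:R * mesh R n)) _.
  rewrite lerB// -sum1_size natr_sum mulr_suml.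
  by apply: ler_sum => a _; rewrite mul1r sum_in_box.
rewrite exchange_big -sumrB; apply: ler_sum => w _.
have pE a : \prod_j ((in_block (r j) (tnth a j) (w j))%:R * mesh R n) =
    [forall j, in_block (r j) (tnth a j) (w j)]%:R * mesh R n ^+ d.
  rewrite big_split/= prodr_const card_ord; congr (_ * _).
  have [/forallP h|/forallPn[j jh]] := boolP [forall j, in_block (r j) (tnth a j) (w j)].
    by apply: big1 => j _; rewrite h.
  by rewrite (bigD1 j)//= (negbTE jh) mul0r.
under eq_bigr do rewrite pE.
have m0 : 0 <= mesh R n ^+ d by rewrite exprn_ge0// ltW// mesh_gt0.
rewrite -mulr_suml -{1}[mesh R n ^+ d]mul1r -mulrBl ler_wpM2r//.
have [_|/allPn[a aA]] := boolP (empty_box A r w).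
  by rewrite lerBlDr lerDl sumr_ge0.
rewrite negbK => aw; rewrite subr_le0 (perm_big _ (perm_to_rem aA)) big_cons/= aw.
by rewrite lerDl sumr_ge0.
Qed.

(** The counting part contributes nothing on empty boxes, and on the others the
    function vanishes; the volume part contributes the same positive amount on
    every empty box, and empty boxes fill half of the cube. *)
Lemma pairing_haar_empty A r : (forall j, r j <= n)%N ->
  (size A)%:R * \prod_j 2 ^- r j <= 1 / 2 :> R ->
  (size A)%:R * \prod_j 2 ^- r j / 4 ^+ d / 2 <= pairing A (haar_empty A r).
Proof.
move=> rn A2.
rewrite pairingE [X in _ <= X - _]big_seq [X in _ <= X - _]big1 ?sub0r => [|a aA]; last first.
  rewrite (sum_haar_odd _ _ (fun j => cell_above (tnth a j)) (haar_empty_odd A r)).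
  rewrite big1// => w _.
  rewrite /haar_empty; have [/allP/(_ _ aA)|_] := boolP (empty_box A r w); last first.
    by rewrite mul0r oppr0 mul0r.
  move=> /forallPn[j jw]; rewrite [X in _ * X](bigD1 j)//= (cell_above_flip _ _ _ (rn j) jw).
  by rewrite subrr !mul0r mulr0.
rewrite (sum_haar_odd _ _ (fun=> cell_integral) (haar_empty_odd A r)) -mulrN -sumrN -!mulrA.
rewrite ler_wpM2l//.
have -> : \sum_w - (haar_empty A r w *
    \prod_j ((cell_integral (w j) - cell_integral (flip_digit (r j) (w j))) / 2)) =
    (\sum_w (empty_box A r w)%:R * mesh R n ^+ d) * (\prod_j 2 ^- r j / 4 ^+ d).
  rewrite mulr_suml; apply: eq_bigr => w _.
  under eq_bigr do rewrite fold_integralE// -mulrA.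
  rewrite !big_split/= !prodr_const card_ord /haar_empty mulNr opprK exprVn.
  have : (\prod_j rademacher (r j) (w j)) * (\prod_j rademacher (r j) (w j)) = 1 :> R.
    by rewrite -big_split/= big1// => j _; rewrite sqr_rademacher.
  move: (\prod_j rademacher _ _) => P PP.
  by rewrite -[RHS]mul1r -[X in _ = X * _]PP !exprVn; ring.
rewrite [leLHS](_ : _ = 1 / 2 * (\prod_j 2 ^- r j / 4 ^+ d)); last by ring.
apply: ler_wpM2r; last by apply: le_trans (sum_empty_box A _ rn); lra.
by rewrite mulr_ge0 ?invr_ge0 ?exprn_ge0// prodr_ge0.
Qed.

End dyadic_grid.
(** * Linearity of the pairing *)

Section pairing_linear.
Context {R : realType} {n d : nat} (A : seq (d.-tuple R)).
Local Notation grid := {ffun 'I_d -> 'I_(2 ^ n.+1)}.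

Lemma pairingB (F G : grid -> R) :
  pairing A (fun w => F w - G w) = pairing A F - pairing A G.
Proof. by rewrite -sumrB; apply: eq_bigr => w _; rewrite mulrBl. Qed.

Lemma pairingZ (c : R) (F : grid -> R) :
  pairing A (fun w => c * F w) = c * pairing A F.
Proof. by rewrite mulr_sumr; apply: eq_bigr => w _; rewrite mulrA. Qed.

Lemma pairing_sum (I : Type) (s : seq I) (P : pred I) (F : I -> grid -> R) :
  pairing A (fun w => \sum_(i <- s | P i) F i w) =
  \sum_(i <- s | P i) pairing A (F i).
Proof. by rewrite exchange_big; apply: eq_bigr => w _; rewrite mulr_suml. Qed.

Lemma eq_pairing (F G : grid -> R) : F =1 G -> pairing A F = pairing A G.
Proof. by move=> FG; apply: eq_bigr => w _; rewrite FG. Qed.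

End pairing_linear.

Lemma prod_exp2V_sumn (R : realType) (t : seq nat) :
  \prod_(j < size t) 2 ^- nth 0%N t j = 2 ^- sumn t :> R.
Proof.
under eq_bigr do rewrite -exprVn.
by rewrite prodrXr sumnE (big_nth 0%N) big_mkord exprVn.
Qed.

Lemma sum_exp2V_le1 (R : realType) (l : nat) :
  \sum_(0 <= k < l) 2 ^- (l - k) <= 1 :> R.
Proof.
elim: l => [|l IH]; first by rewrite big_geq.
rewrite big_nat_recr//= subSnn expr1.
rewrite [X in X + _](_ : _ = 2^-1 * \sum_(0 <= k < l) 2 ^- (l - k)); last first.
  rewrite mulr_sumr; apply: eq_big_nat => k /andP[_ kl].
  by rewrite subSn ?(ltnW kl)// exprS invfM.
lra.
Qed.

(** * Riesz products of Haar layers *)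

Section riesz_grid.
Context {R : realType} {q n M : nat} (A : seq (q.+2.-tuple R)) (s : seq nat) (delta : R).
Hypothesis size_s : size s = q.
Hypothesis Ms : (M + sumn s <= n)%N.
Hypothesis delta_ge0 : 0 <= delta.
Hypothesis delta_le : delta ^+ 2 * M%:R <= 1.
Local Notation grid := {ffun 'I_q.+2 -> 'I_(2 ^ n.+1)}.

(** The exponents k in the first coordinate, s in the middle ones and m in the
    last one. *)
Definition depths (k m : nat) (j : 'I_q.+2) : nat := nth 0%N (k :: rcons s m) j.

(** The last exponent is adjusted so that all of them sum to n. *)
Definition layer_depths (k : nat) := depths k (n - k - sumn s).

Definition layer (k : nat) (w : grid) : R := haar_empty A (layer_depths k) w.

Definition riesz_part (k l : nat) (w : grid) : R :=
  complex.Im (riesz (fun j => delta * layer j w) k l).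

Lemma depths_middle k m k' m' (j : 'I_q.+2) : j != ord0 -> j != ord_max ->
  depths k m j = depths k' m' j.
Proof.
rewrite /depths; case: j => -[//|j] /= jq _; rewrite -(inj_eq val_inj)/= eqSS => jq'.
rewrite !nth_rcons size_s; by case: ltngtP => // h; rewrite h eqxx in jq'.
Qed.

Lemma depths_first k m : depths k m ord0 = k.
Proof. by []. Qed.

Lemma depths_last k m : depths k m ord_max = m.
Proof. by rewrite /depths/= nth_rcons size_s ltnn eqxx. Qed.

Lemma prod_depths k m : \prod_j 2 ^- depths k m j = 2 ^- (k + sumn s + m) :> R.
Proof.
have -> : (k + sumn s + m = sumn (k :: rcons s m))%N.
  by rewrite /= sumn_rcons addnA.
rewrite -prod_exp2V_sumn.
have -> // : size (k :: rcons s m) = q.+2 by rewrite /= size_rcons size_s.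
Qed.

Lemma depths_le k m (j : 'I_q.+2) : (k <= n)%N -> (m <= n)%N -> (depths k m j <= n)%N.
Proof.
move=> kn mn; have : all (fun t => t <= n)%N (k :: rcons s m).
  rewrite /= all_rcons kn mn/=; apply/allP => t ts.
  apply: leq_trans Ms; apply: leq_trans (leq_addl _ _).
  by rewrite (perm_sumn (perm_to_rem ts))/= leq_addr.
move/all_nthP; apply; rewrite /= size_rcons size_s; exact: ltn_ord.
Qed.

Lemma layer_depths_le k j : (k < M)%N -> (layer_depths k j <= n)%N.
Proof.
move=> kM; apply: depths_le; last by rewrite -subnDA leq_subr.
by apply: leq_trans (ltnW kM) _; apply: leq_trans Ms; exact: leq_addr.
Qed.

(** All the layers have the same exponent in a middle coordinate, so flipping the
    digit at that level changes the sign of each of them. *)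
Lemma riesz_part_odd k l (j : 'I_q.+2) w : j != ord0 -> j != ord_max ->
  riesz_part k l (flip_at j (layer_depths 0 j) w) = - riesz_part k l w.
Proof.
move=> j0 jm; rewrite /riesz_part -Im_riesz_opp; congr (complex.Im (riesz _ _ _)).
apply: funext => i; rewrite /layer -mulrN.
rewrite [layer_depths 0 j](depths_middle _ _ i (n - i - sumn s) _ j0 jm).
by rewrite haar_empty_odd.
Qed.

Lemma riesz_part_inv k l (j : 'I_q.+2) t w :
  (forall i, (k <= i < l)%N -> layer_depths i j < t <= n)%N ->
  riesz_part k l (flip_at j t w) = riesz_part k l w.
Proof.
move=> tn; rewrite /riesz_part /riesz; congr complex.Im.
by apply: eq_big_nat => i ikl; rewrite /layer haar_empty_inv// tn.
Qed.

Lemma sqr_riesz_part_le k l w : (l - k <= M)%N -> riesz_part k l w ^+ 2 <= expR 1.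
Proof.
move=> klM; apply: (@le_trans _ _ (\prod_(k <= j < l) (1 + (delta * layer j w) ^+ 2))).
  by rewrite -sqr_riesz lerDr sqr_ge0.
apply: (@le_trans _ _ (\prod_(k <= j < l) expR (delta ^+ 2))).
  apply: ler_prod => j _; rewrite addr_ge0 ?sqr_ge0//=.
  apply: le_trans (expR_ge1Dx _); rewrite lerD2l// exprMn.
  rewrite ler_piMr ?sqr_ge0// -real_normK ?num_real//.
  by rewrite exprn_ile1// haar_empty_le1.
rewrite prodr_const_nat -expRM_natr ler_expR; apply: le_trans delta_le.
by rewrite ler_wpM2l ?sqr_ge0// ler_nat.
Qed.

Lemma riesz_part_le k l w : (l - k <= M)%N -> `|riesz_part k l w| <= expR 1.
Proof.
move=> klM; rewrite -(ler_pXn2r (n := 2))// ?nnegrE ?expR_ge0//.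
rewrite real_normK ?num_real//; apply: le_trans (sqr_riesz_part_le _ _ _ klM) _.
by rewrite -[leLHS]expr1 ler_weXn2l// ltW// expR_gt1.
Qed.

(** In the first coordinate the exponents increase with the index of the layer,
    and in the last one they decrease.  So only layer l has the finest digit of
    the first coordinate and only layer k that of the last one.  In a middle
    coordinate there are three odd factors. *)
Lemma haar_odd_layers k l : (k < l < M)%N ->
  haar_odd (depths l (n - k - sumn s))
    (fun w => layer l w * layer k w * riesz_part k.+1 l w).
Proof.
move=> /andP[kl lM] j w.
have ln : (l <= n)%N.
  by apply: leq_trans (ltnW lM) _; apply: leq_trans Ms; exact: leq_addr.
have layer_inv i t v : (layer_depths i v < t <= n)%N ->
    layer i (flip_at v t w) = layer i w by exact: haar_empty_inv.
have layer_odd i v t : t = layer_depths i v -> layer i (flip_at v t w) = - layer i w.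
  by move=> ->; exact: haar_empty_odd.
have [->|j0] := eqVneq j ord0.
  rewrite layer_odd// layer_inv; last by rewrite depths_first kl.
  rewrite riesz_part_inv; first by rewrite !mulNr.
  by move=> i /andP[_ il]; rewrite depths_first; apply/andP.
have [->|jm] := eqVneq j ord_max.
  have lt_depth i : (k < i < M)%N ->
      (layer_depths i ord_max < depths l (n - k - sumn s) ord_max <= n)%N.
    move=> /andP[ki iM]; rewrite /layer_depths !depths_last; lia.
  rewrite (layer_inv l); last by apply: lt_depth; rewrite kl.
  rewrite (layer_odd k); last by rewrite /layer_depths !depths_last.
  rewrite riesz_part_inv; first by rewrite mulrN mulNr.
  by move=> i /andP[ki il]; apply: lt_depth; rewrite ki (ltn_trans il).
rewrite !layer_odd ?mulrNN; try exact: depths_middle.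
rewrite (depths_middle _ _ 0 (n - 0 - sumn s) _ j0 jm).
by rewrite riesz_part_odd// mulrN.
Qed.

Lemma prod_layer_depths k : (k < M)%N ->
  \prod_j 2 ^- layer_depths k j = 2 ^- n :> R.
Proof. by move=> kM; rewrite prod_depths; congr (2 ^- _); lia. Qed.

(** The sum over k < l of 2^-(l - k) is at most 1 for each l, so the terms of
    order two and more amount to at most delta^2 M e in total. *)
Lemma pairing_riesz :
  (size A)%:R * 2 ^- n <= 1 / 2 :> R -> 2 ^- q.+2 <= (size A)%:R * 2 ^- n :> R ->
  delta * M%:R * (2 ^- q.+2 / 4 ^+ q.+2 / 2) - delta ^+ 2 * M%:R * expR 1 <=
  pairing A (riesz_part 0 M).
Proof.
move=> A_le A_ge.
rewrite (eq_pairing _ _ _ (fun w => Im_rieszE (fun j => delta * layer j w) M)).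
rewrite pairingB !pairing_sum; apply: lerB.
  rewrite mulrAC -[M in leLHS]subn0 mulr_natr -sumr_const_nat.
  apply: ler_sum_nat => k /andP[_ kM]; rewrite pairingZ ler_wpM2l//.
  apply: le_trans (pairing_haar_empty A _ _ _); rewrite ?prod_layer_depths//.
    by rewrite ler_pM2r ?invr_gt0// ler_pM2r// invr_gt0 exprn_gt0.
  by move=> j; exact: layer_depths_le.
rewrite mulrAC -[M in leRHS]subn0 mulr_natr -sumr_const_nat.
apply: ler_sum_nat => l /andP[_ lM]; rewrite pairing_sum.
apply: (@le_trans _ _ (\sum_(0 <= k < l) delta ^+ 2 * expR 1 * 2 ^- (l - k))); last first.
  by rewrite -mulr_sumr ler_piMr ?sum_exp2V_le1// mulr_ge0 ?sqr_ge0 ?expR_ge0.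
apply: ler_sum_nat => k /andP[_ kl]; have klM : (k < l < M)%N by rewrite kl.
rewrite (eq_pairing _ _ (fun w => delta ^+ 2 * (layer l w * layer k w * riesz_part k.+1 l w)));
  last by move=> w; rewrite /riesz_part; ring.
rewrite pairingZ -mulrA ler_wpM2l ?sqr_ge0//; apply: le_trans (ler_norm _) _.
apply: le_trans (pairing_le A _ _ (expR 1) _ (haar_odd_layers k l klM) _) _.
- by move=> j; apply: depths_le; lia.
- move=> w; rewrite !normrM -[leRHS]mul1r ler_pM ?mulr_ge0//.
    by rewrite mulr_ile1// haar_empty_le1.
  by apply: riesz_part_le; lia.
rewrite prod_depths (_ : (_ + _ + _)%N = (n + (l - k))%N); last by lia.
rewrite exprD invfM mulrA ler_wpM2r ?invr_ge0 ?exprn_ge0//.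
rewrite [leRHS](_ : _ = 2 * expR 1 * (1 / 2)); last by field.
by rewrite -mulrA ler_wpM2l// mulr_ge0 ?expR_ge0.
Qed.

End riesz_grid.
(** * The test function *)

Section test_function.
Context {R : realType} {q M n : nat} (A : seq (q.+2.-tuple R)) (delta : R).
Hypothesis nM : n = (q.+1 * M)%N.
Hypothesis delta_ge0 : 0 <= delta.
Hypothesis delta_le : delta ^+ 2 * M%:R <= 1.
Local Notation grid := {ffun 'I_q.+2 -> 'I_(2 ^ n.+1)}.

Definition middle_depths (s : q.-tuple 'I_M) : seq nat := map val s.

Lemma size_middle_depths s : size (middle_depths s) = q.
Proof. by rewrite size_map size_tuple. Qed.

Lemma sum_middle_depths s : (M + sumn (middle_depths s) <= n)%N.
Proof.
rewrite nM mulSn leq_add2l -[X in (_ <= X * _)%N](size_tuple s) /middle_depths.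
elim: (val s) => //= t u IH; rewrite mulSn leq_add//.
exact: ltnW.
Qed.

Definition test_function (w : grid) : R :=
  \sum_(s : q.-tuple 'I_M) riesz_part A (middle_depths s) delta 0 M w.

(** The first and the last coordinates enter only through the boundedness of the
    Riesz products; the q middle ones carry the martingale structure. *)
Lemma moment_test_function (k : nat) :
  mesh R n ^+ q.+2 * \sum_w test_function w ^+ k.+1.*2 <=
  ((k.+1.*2 * M)%:R ^+ q * expR 1) ^+ k.+1.
Proof.
have val_inordS (i : 'I_q) : (inord i.+1 : 'I_q.+2) = i.+1 :> nat.
  by rewrite /= inordK// !ltnS ltnW// ltn_ord.
have middle (i : 'I_q) : (inord i.+1 : 'I_q.+2) != ord0 /\ (inord i.+1 : 'I_q.+2) != ord_max.
  by split; rewrite -val_eqE/= val_inordS// eqSS neq_ltn ltn_ord.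
have depth_tnth (s : q.-tuple 'I_M) m (i : 'I_q) :
    @layer_depths q n (middle_depths s) m (inord i.+1) = tnth s i.
  rewrite /layer_depths /depths val_inordS/= nth_rcons size_middle_depths.
  by rewrite ltn_ord (nth_map (tnth s i)) ?size_tuple// -tnth_nth.
rewrite mulrC -ler_pdivlMr ?exprn_gt0 ?mesh_gt0//.
pose a := expR 1 ^+ k.+1 / mesh R n ^+ q.+2.
rewrite exprMn -exprM (mulnC q) -mulrA.
apply: (moment_sum_tuple _ _ k M q (fun i t => flip_at (inord i.+1) t)).
- by move=> i t; exact: flip_atK.
- move=> s w i; have [i0 im] := middle i.
  rewrite -[X in flip_at _ X _](depth_tnth s 0%N).
  by apply: riesz_part_odd => //; exact: size_middle_depths.
- move=> s w i u /andP[su uM]; apply: riesz_part_inv => j _.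
  by rewrite depth_tnth su (leq_trans (ltnW uM))// nM leq_pmull.
- by rewrite mulr_ge0 ?exprn_ge0 ?expR_ge0// invr_ge0 exprn_ge0// ltW// mesh_gt0.
- move=> s; rewrite ler_pdivlMr ?exprn_gt0 ?mesh_gt0// mulr_suml.
  rewrite -[leRHS]mulr1 -[X in _ <= _ * X](@sum_mesh1 R n q.+2) mulr_sumr; apply: ler_sum => w _.
  apply: ler_wpM2r; first by rewrite exprn_ge0// ltW// mesh_gt0.
  rewrite -mul2n exprM lerXn2r ?nnegrE ?sqr_ge0 ?expR_ge0//.
  by apply: (sqr_riesz_part_le _ _ _ delta_le); rewrite subn0.
Qed.

Lemma pairing_test_function :
  (size A)%:R * 2 ^- n <= 1 / 2 :> R -> 2 ^- q.+2 <= (size A)%:R * 2 ^- n :> R ->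
  M%:R ^+ q * (delta * M%:R * (2 ^- q.+2 / 4 ^+ q.+2 / 2) -
    delta ^+ 2 * M%:R * expR 1) <= pairing A test_function.
Proof.
move=> A_le A_ge.
rewrite /test_function pairing_sum -natrX.
have <- : #|{: q.-tuple 'I_M}| = (M ^ q)%N by rewrite card_tuple card_ord.
rewrite mulr_natl -sumr_const; apply: ler_sum => s _; apply: pairing_riesz => //.
  exact: size_middle_depths.
exact: sum_middle_depths.
Qed.

End test_function.

(** With delta = eps / sqrt M, the lower bound for each Riesz product is
    c0 eps sqrt M - eps^2 e; the choice of eps makes the second term half of
    c0 eps. *)
Lemma exists_test_function (R : realType) (q : nat) : exists2 c : R, 0 < c &
  forall (M : nat) (A : seq (q.+2.-tuple R)), (0 < M)%N ->
    (size A)%:R * 2 ^- (q.+1 * M) <= 1 / 2 :> R ->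
    2 ^- q.+2 <= (size A)%:R * 2 ^- (q.+1 * M) :> R ->
  exists2 S : {ffun 'I_q.+2 -> 'I_(2 ^ (q.+1 * M).+1)} -> R,
    c * (M%:R ^+ q * Num.sqrt M%:R) <= pairing A S &
    forall k, mesh R (q.+1 * M) ^+ q.+2 * \sum_w S w ^+ k.+1.*2 <=
      ((k.+1.*2 * M)%:R ^+ q * expR 1) ^+ k.+1.
Proof.
pose c0 : R := 2 ^- q.+2 / 4 ^+ q.+2 / 2.
have c00 : 0 < c0 by rewrite !divr_gt0 ?invr_gt0 ?exprn_gt0.
have e0 : (1 : R) <= expR 1 by rewrite ltW// expR_gt1.
pose eps : R := c0 / (2 * expR 1).
have eps0 : 0 < eps by rewrite divr_gt0// mulr_gt0// (lt_le_trans _ e0).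
exists (c0 * eps / 2) => [|M A M0 A_le A_ge]; first by rewrite divr_gt0// mulr_gt0.
have MR : (0 : R) < M%:R by rewrite ltr0n.
have sM : 0 < Num.sqrt M%:R :> R by rewrite sqrtr_gt0.
have sMM : Num.sqrt M%:R * Num.sqrt M%:R = M%:R :> R by rewrite -expr2 sqr_sqrtr// ltW.
pose delta : R := eps / Num.sqrt M%:R.
have delta0 : 0 <= delta by rewrite divr_ge0 ?ltW.
have dM : delta ^+ 2 * M%:R = eps ^+ 2.
  by rewrite /delta -{2}sMM; field; rewrite gt_eqF.
have dM1 : delta * M%:R = eps * Num.sqrt M%:R.
  by rewrite /delta -{2}sMM; field; rewrite gt_eqF.
have eps1 : eps <= 1.
  rewrite ler_pdivrMr ?mulr_gt0 ?expR_gt0// mul1r.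
  apply: (@le_trans _ _ 1); last by lra.
  have inv_le1 (k : nat) : (0 < k)%N -> (k%:R ^+ q.+2)^-1 <= 1 :> R.
    by move=> k0; rewrite invf_le1 ?exprn_gt0 ?ltr0n// exprn_ege1// ler1n.
  rewrite /c0 !mulr_ile1 ?mulr_ge0 ?invr_ge0 ?exprn_ge0 ?inv_le1//.
  lra.
exists (@test_function R q M _ A delta).
  apply: le_trans (pairing_test_function A delta erefl delta0 _ A_le A_ge).
    rewrite mulrCA; apply: ler_wpM2l; first by rewrite exprn_ge0.
    rewrite dM dM1 -/c0.
    have -> : eps ^+ 2 * expR 1 = c0 * eps / 2.
      by rewrite /eps; field; rewrite gt_eqF// expR_gt0.
    have -> : eps * Num.sqrt M%:R * c0 = c0 * eps * Num.sqrt M%:R by ring.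
    have : 1 <= Num.sqrt M%:R :> R by rewrite -[X in X <= _]sqrtr1 ler_wsqrtr// ler1n.
    have : 0 < c0 * eps by rewrite mulr_gt0.
    move: (Num.sqrt _) (c0 * eps) => x y y0 x1; nra.
  by rewrite dM exprn_ile1// ltW.
by move=> k; apply: moment_test_function => //; rewrite dM exprn_ile1// ltW.
Qed.
(** * Integrals over cells *)

(** The integral of a nonnegative function is a supremum over the simple functions
    below it, so monotonicity holds without measurability.  This allows the
    comparison with the Young function and with the discrepancy function
    themselves. *)
Lemma ge0_le_integral_nonmeasurable d (T : measurableType d) (R : realType)
    (mu : {measure set T -> \bar R}) (f g : T -> \bar R) :
  (forall x, (0 <= f x)%E) -> (forall x, (f x <= g x)%E) ->
  (\int[mu]_x f x <= \int[mu]_x g x)%E.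
Proof.
move=> f0 fg; have g0 x : (0 <= g x)%E by exact: le_trans (fg x).
rewrite !ge0_integralTE//; apply: ereal_sup_le => _ [h hf <-].
by exists h => // x; exact: le_trans (hf x) (fg x).
Qed.

(** Tonelli, one coordinate at a time along the construction of the measure. *)
Lemma integral_tuple_prod (R : realType) (d : nat) (f : 'I_d -> R -> R) (c : 'I_d -> R) :
  (forall i, measurable_fun setT (f i)) -> (forall i x, 0 <= f i x) ->
  (forall i, \int[lebesgue_measure]_x (f i x)%:E = (c i)%:E)%E ->
  (\int[lebesgue_measure_tuple R d]_t (\prod_i f i (tnth t i))%:E = (\prod_i c i)%:E)%E.
Proof.
have mp (n : nat) (g : 'I_n -> R -> R) : (forall i, measurable_fun setT (g i)) ->
    measurable_fun setT (fun t : Rtuple R n => (\prod_i g i (tnth t i))%:E).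
  move=> mg; apply/measurable_EFinP; apply: measurable_prod => i _.
  exact: measurableT_comp (mg i) (measurable_tnth i).
elim: d f c => [|d IH] f c mf f0 fc.
  rewrite big_ord0 /= integral_dirac//; last exact: mp.
  rewrite diracE in_setT mul1e.
  by rewrite big_ord0.
rewrite /= /cons_measure (ge0_integral_pushforward (@measurable_cons_pair R d))//; last 2 first.
- exact: mp.
- by move=> t _; rewrite lee_fin prodr_ge0.
rewrite preimage_setT fubini_tonelli1; last 2 first.
- apply: measurableT_comp; first exact: mp.
  exact: measurable_cons_pair.
- by move=> t /=; rewrite lee_fin prodr_ge0.
transitivity (\int[lebesgue_measure]_x
    ((f ord0 x)%:E * (\prod_(i < d) c (lift ord0 i))%:E))%E.
  apply: eq_integral => x _; rewrite /fubini_F.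
  rewrite -(IH (fun i => f (lift ord0 i)) (fun i => c (lift ord0 i)))//.
  rewrite -ge0_integralZl//; last 3 first.
  - exact: (mp d (fun i => f (lift ord0 i))).
  - by move=> t _; rewrite lee_fin prodr_ge0.
  - by rewrite lee_fin.
  apply: eq_integral => t _; rewrite /= big_ord_recl EFinM; congr (_ * _%:E)%E.
  by apply: eq_bigr => i _; rewrite tnthS.
rewrite ge0_integralZr//; last 3 first.
- by apply/measurable_EFinP; exact: mf.
- by move=> x _; rewrite lee_fin.
- rewrite -(IH (fun i => f (lift ord0 i)) (fun i => c (lift ord0 i)))//.
  by apply: integral_ge0 => t _; rewrite lee_fin prodr_ge0.
by rewrite fc -EFinM big_ord_recl.
Qed.

Section boxes.
Context {R : realType} {n d : nat}.
Local Notation grid := {ffun 'I_d -> 'I_(2 ^ n.+1)}.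

Definition box (w : grid) : set (Rtuple R d) := [set t | forall j, cell (w j) (tnth t j)].

Lemma measurable_box (w : grid) : measurable (box w).
Proof.
by apply: (measurable_tuple_rect (A := fun j => cell (w j))) => j; exact: measurable_itv.
Qed.

Lemma indic_box (w : grid) t : \1_(box w) t = \prod_j \1_(cell (w j)) (tnth t j) :> R.
Proof.
rewrite indicE; have [tw|tw] := pselect (box w t).
  rewrite mem_set// big1// => j _; rewrite indicE mem_set//; exact: tw.
rewrite memNset//; have [j jw] : exists j, ~ cell (w j) (tnth t j).
  by apply/existsNP.
by rewrite (bigD1 j)//= indicE memNset// mul0r.
Qed.

Lemma integral_box (w : grid) (u : 'I_d -> R -> R) (c : 'I_d -> R) :
  (forall j, measurable_fun setT (u j)) ->
  (forall j x, cell (w j) x -> 0 <= u j x) ->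
  (forall j, \int[lebesgue_measure]_(x in cell (w j)) (u j x)%:E = (c j)%:E)%E ->
  (\int[lebesgue_measure_tuple R d]_(t in box w) (\prod_j u j (tnth t j))%:E =
   (\prod_j c j)%:E)%E.
Proof.
move=> mu u0 uc.
have restr (T : Type) (h : T -> R) (D : set T) x :
    ((EFin \o h) \_ D) x = (h x * \1_D x)%:E.
  by rewrite patchE indicE; case: ifP => _ /=; rewrite ?mulr1 ?mulr0.
rewrite -(integral_tuple_prod R d (fun j x => u j x * \1_(cell (w j)) x) c).
- rewrite integral_mkcond; apply: eq_integral => t _.
  by rewrite (restr _ (fun t => \prod_j u j (tnth t j))) indic_box big_split.
- move=> j; apply: measurable_funM; first exact: mu.
  by apply: measurable_indic; exact: measurable_itv.
- move=> j x; rewrite indicE; case: (boolP (x \in _)) => [xw|_]; last by rewrite mulr0.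
  by rewrite mulr1 u0// -in_setE.
- move=> j; rewrite -uc [in RHS]integral_mkcond; apply: eq_integral => x _.
  by rewrite -(restr _ (u j)).
Qed.

Lemma measure_box (w : grid) : lebesgue_measure_tuple R d (box w) = (mesh R n ^+ d)%:E.
Proof.
rewrite (lebesgue_measure_tuple_rect (A := fun j => cell (w j))); last first.
  by move=> j; exact: measurable_itv.
under eq_bigr do rewrite lebesgue_measure_cell.
by rewrite prodEFin prodr_const card_ord.
Qed.

Lemma box_sub_cube (w : grid) : box w `<=` unit_cube R d.
Proof.
move=> t tw j; have := tw j; rewrite /cell/= in_itv/= => /andP[h1 h2].
have m0 := @mesh_gt0 R n.
rewrite (le_trans _ h1) ?mulr_ge0 ?(ltW m0)//=; apply: le_trans (ltW h2) _.
rewrite /mesh ler_pdivrMr ?exprn_gt0// mul1r -natrX ler_nat.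
exact: ltn_ord.
Qed.

Lemma trivIset_box (D : set grid) : trivIset D box.
Proof.
apply/trivIsetP => w w' _ _ ww'; apply/seteqP; split => t //= -[tw tw'].
apply/negP: ww'; rewrite negbK; apply/eqP/ffunP => j; apply: val_inj => /=.
have m0 := @mesh_gt0 R n.
have := tw j; have := tw' j; rewrite /cell/= !in_itv/= => /andP[h1 h2] /andP[h3 h4].
have := le_lt_trans h1 h4; have := le_lt_trans h3 h2.
rewrite !ltr_pM2r// !ltr_nat !ltnS => h5 h6.
by apply/eqP; rewrite eqn_leq h5 h6.
Qed.

Lemma integral_cell_id (w : 'I_(2 ^ n.+1)) :
  (\int[lebesgue_measure]_(x in cell w) (x : R)%:E = (cell_integral w : R)%:E)%E.
Proof.
have m0 := @mesh_gt0 R n.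
have ab : w%:R * mesh R n < w.+1%:R * mesh R n by rewrite ltr_pM2r// ltr_nat.
rewrite /cell integral_itv_bndo_bndc; last first.
  by apply/measurable_EFinP; apply: measurable_funTS; exact: measurable_id.
pose p : {poly R} := 2^-1 *: 'X^2.
rewrite (continuous_FTC2 (F := horner p))//.
- by rewrite -EFinB !hornerZ !hornerXn /cell_integral -natr1; congr EFin; field.
- by apply: continuous_subspaceT => x; exact: cvg_id.
- split; first by move=> x _; exact: derivable_horner.
    by apply: cvg_at_right_filter; exact: continuous_horner.
  by apply: cvg_at_left_filter; exact: continuous_horner.
- move=> x _; rewrite derive1E derive_val derivZ derivXn hornerZ hornerMn hornerXn expr1.
  by rewrite -[X in _ * X]mulr_natl mulrA mulVf// mul1r.
Qed.

End boxes.
Section discrepancy_integrals.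
Context {R : realType} {n d : nat}.
Local Notation grid := {ffun 'I_d -> 'I_(2 ^ n.+1)}.
Local Notation mu := (lebesgue_measure_tuple R d).

Lemma integrable_box (w : grid) (u : 'I_d -> R -> R) (c : 'I_d -> R) :
  (forall j, measurable_fun setT (u j)) ->
  (forall j x, cell (w j) x -> 0 <= u j x) ->
  (forall j, \int[lebesgue_measure]_(x in cell (w j)) (u j x)%:E = (c j)%:E)%E ->
  mu.-integrable (box w) (fun t => (\prod_j u j (tnth t j))%:E).
Proof.
move=> mu_ u0 uc; apply/integrableP; split.
  apply/measurable_EFinP; apply: measurable_funTS; apply: measurable_prod => i _.
  exact: measurableT_comp (mu_ i) (measurable_tnth i).
rewrite (_ : (\int[_]_(x in _) _)%E = (\prod_j c j)%:E) ?ltry//.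
rewrite -(integral_box _ _ _ mu_ u0 uc); apply: eq_integral => t /set_mem tw.
by rewrite gee0_abs// lee_fin prodr_ge0// => j _; apply/u0/tw.
Qed.

(** The discrepancy function as a polynomial in one-dimensional functions; the two
    agree on the cube ([discrepancyE]). *)
Definition explicit_discrepancy (A : seq (d.-tuple R)) (x : Rtuple R d) : R :=
  \sum_(a <- A) \prod_j \1_(`]tnth a j, +oo[ : set R) (tnth x j) -
  (size A)%:R * \prod_j tnth x j.

Lemma measurable_explicit_discrepancy A : measurable_fun setT (explicit_discrepancy A).
Proof.
apply: measurable_funB.
  apply: measurable_sum => a; apply: measurable_prod => j _.
  have mI : measurable_fun setT (\1_(`]tnth a j, +oo[ : set R) : R -> R).
    by apply: measurable_indic; exact: measurable_itv.
  exact: measurableT_comp mI (measurable_tnth j).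
apply: measurable_funM; first exact: measurable_cst.
by apply: measurable_prod => j _; exact: measurable_tnth.
Qed.

Let mbox (w : grid) : measurable (box (R := R) w) := measurable_box w.

Let id_ge0 (w : grid) : forall j x, cell (w j) x -> (0 : R) <= x.
Proof.
move=> j x; rewrite /cell/= in_itv/= => /andP[h _]; apply: le_trans h.
by rewrite mulr_ge0// ltW// mesh_gt0.
Qed.

Let integral_above (w : grid) (a : d.-tuple R) j :
  (\int[lebesgue_measure]_(x in cell (w j)) (\1_(`]tnth a j, +oo[ : set R) x)%:E =
  (cell_above (tnth a j) (w j))%:E)%E.
Proof.
rewrite integral_indic; [|exact: measurable_itv|exact: measurable_itv].
by rewrite setIC; exact: lebesgue_measure_cell_above.
Qed.

Let measurable_above (a : d.-tuple R) (j : 'I_d) :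
  measurable_fun setT (\1_(`]tnth a j, +oo[ : set R) : R -> R).
Proof. by apply: measurable_indic; exact: measurable_itv. Qed.

Let above_ge0 (w : grid) (a : d.-tuple R) (j : 'I_d) (x : R) : cell (w j) x ->
  (0 : R) <= \1_(`]tnth a j, +oo[ : set R) x.
Proof. by []. Qed.

Let integrable_count A (w : grid) : mu.-integrable (box w)
  (fun x => (\sum_(a <- A) \prod_j \1_(`]tnth a j, +oo[ : set R) (tnth x j))%:E).
Proof.
rewrite (_ : (fun x => _) = (fun x =>
  \sum_(a <- A) (\prod_j \1_(`]tnth a j, +oo[ : set R) (tnth x j))%:E)%E).
  apply: integrable_sum => // a _.
  exact: integrable_box (measurable_above a) (above_ge0 w a) (integral_above w a).
by apply/funext => x; rewrite sumEFin.
Qed.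

Let integrable_volume (c : R) (w : grid) : mu.-integrable (box w)
  (fun x => (c * \prod_j tnth x j)%:E).
Proof.
rewrite (_ : (fun x => _) = (fun x : Rtuple R d => c%:E * (\prod_j tnth x j)%:E)%E)//.
apply: integrableZl => //.
apply: (integrable_box _ (fun=> id) (fun j => cell_integral (w j))) => j.
- exact: measurable_id.
- exact: id_ge0.
- exact: integral_cell_id.
Qed.

Lemma integrable_discrepancy_box A (w : grid) :
  mu.-integrable (box w) (fun x => (explicit_discrepancy A x)%:E).
Proof.
exact: (integrableB (mbox w) (integrable_count A w) (integrable_volume (size A)%:R w)).
Qed.

Lemma integral_discrepancy_box A (w : grid) :
  (\int[mu]_(x in box w) (explicit_discrepancy A x)%:E = (cell_discrepancy A w)%:E)%E.
Proof.
under eq_integral do rewrite EFinB.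
rewrite (integralB_EFin (mbox w) (integrable_count A w) (integrable_volume _ w)).
rewrite /cell_discrepancy EFinB; congr (_ - _)%E.
  under eq_integral do rewrite -sumEFin.
  rewrite integral_sum//; last first.
    move=> a.
    exact: integrable_box (measurable_above a) (above_ge0 w a) (integral_above w a).
  rewrite -sumEFin; apply: eq_bigr => a _.
  exact: integral_box (measurable_above a) (above_ge0 w a) (integral_above w a).
under eq_integral do rewrite EFinM.
rewrite integralZl//; last first.
  by have := integrable_volume 1 w; under eq_fun do rewrite mul1r.
rewrite EFinM; congr (_ * _)%E.
apply: (integral_box _ (fun=> id) (fun j => cell_integral (w j))) => j.
- exact: measurable_id.
- exact: id_ge0.
- exact: integral_cell_id.
Qed.

Lemma sum_integral_box_le (f : Rtuple R d -> R) :
  measurable_fun setT f -> (forall x, 0 <= f x) ->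
  (\sum_(w : grid) \int[mu]_(x in box w) (f x)%:E <=
   \int[unit_cube_measure R d]_(x in unit_cube R d) (f x)%:E)%E.
Proof.
move=> mf f0; have mEf D : measurable_fun D (EFin \o f).
  by apply/measurable_EFinP; exact: measurable_funTS.
apply: (@le_trans _ _ (\int[mu]_(x in unit_cube R d) (f x)%:E)%E).
  rewrite -(ge0_integral_bigsetU mu mbox (index_enum_uniq _)) => [|||x _].
  - apply: ge0_subset_integral => //.
    + exact: bigsetU_measurable.
    + exact: measurable_unit_cube.
    + by move=> x _; rewrite lee_fin.
    + by move=> x; rewrite -bigcup_seq => -[w _]; exact: box_sub_cube.
  - exact: trivIset_box.
  - exact: mEf.
  - by rewrite lee_fin.
rewrite le_eqVlt; apply/orP; left; apply/eqP.
apply: eq_measure_integral => D mD DC.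
by rewrite /= /unit_cube_measure /mrestr setIidl.
Qed.

(** Integrating a pointwise Young-type inequality over each cell and summing: the
    cells are disjoint and contained in the cube. *)
Lemma pairing_le_integral (A : seq (d.-tuple R)) (g T : grid -> R) (psi : R -> R) (K B : R) :
  measurable_fun setT psi -> (forall x, 0 <= psi x) ->
  (forall w x, box w x -> explicit_discrepancy A x / K * g w <=
     psi (explicit_discrepancy A x / K) + T w) ->
  (\int[unit_cube_measure R d]_(x in unit_cube R d)
    (psi (explicit_discrepancy A x / K))%:E <= B%:E)%E ->
  pairing A g / K <= B + mesh R n ^+ d * \sum_w T w.
Proof.
move=> mpsi psi0 gT intB; pose f x := psi (explicit_discrepancy A x / K).
have mf : measurable_fun setT f.
  apply: measurableT_comp => //; apply: measurable_funM; last exact: measurable_cst.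
  exact: measurable_explicit_discrepancy.
have f0 x : 0 <= f x by exact: psi0.
have mEf D : measurable_fun D (EFin \o f).
  by apply/measurable_EFinP; exact: measurable_funTS.
have sumB := le_trans (sum_integral_box_le _ mf f0) intB.
have int0 (w : grid) : (0 <= \int[mu]_(x in box w) (f x)%:E)%E.
  by apply: integral_ge0 => x _; rewrite lee_fin.
have int_fin (w : grid) : (\int[mu]_(x in box w) (f x)%:E < +oo)%E.
  apply: (@le_lt_trans _ _ B%:E); last exact: ltry.
  apply: le_trans sumB; rewrite (bigD1 w)//= leeDl//.
  by apply: sume_ge0 => w' _; exact: int0.
have intf (w : grid) : mu.-integrable (box w) (EFin \o f).
  apply/integrableP; split; first exact: mEf.
  by under eq_integral do rewrite gee0_abs ?lee_fin//.
have int_cst (w : grid) (c : R) :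
    (\int[mu]_(x in box w) (cst c%:E x) = (c * mesh R n ^+ d)%:E)%E.
  rewrite integral_cst// EFinM; congr (_ * _)%E; exact: measure_box.
have intT (w : grid) : mu.-integrable (box w) (cst (T w)%:E).
  apply/integrableP; split; first exact: measurable_cst.
  by rewrite (int_cst w `|T w|) ltry.
have step (w : grid) : ((g w / K * cell_discrepancy A w)%:E <=
    \int[mu]_(x in box w) (f x)%:E + (T w * mesh R n ^+ d)%:E)%E.
  rewrite EFinM -integral_discrepancy_box -integralZl//; last exact: integrable_discrepancy_box.
  rewrite -(int_cst w) -integralD//.
  apply: le_integral => //.
  - by apply: integrableZl => //; exact: integrable_discrepancy_box.
  - exact: integrableD.
  - move=> x /set_mem xw; rewrite -EFinM -EFinD lee_fin.
    rewrite [leLHS](_ : _ = explicit_discrepancy A x / K * g w); first exact: gT.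
    by ring.
rewrite -lee_fin EFinD.
have -> : (pairing A g / K)%:E = (\sum_(w : grid) (g w / K * cell_discrepancy A w)%:E)%E.
  rewrite sumEFin /pairing mulr_suml; congr EFin; apply: eq_bigr => w _.
  by rewrite mulrAC.
apply: le_trans (lee_sum _ (fun w _ => step w)) _.
rewrite big_split/= leeD// sumEFin lee_fin mulr_sumr.
by apply: ler_sum => w _; rewrite mulrC.
Qed.

End discrepancy_integrals.

Lemma discrepancyE (R : realType) (d : nat) (A : {fset Rtuple R d}) (x : Rtuple R d) :
  [set` A] `<=` unit_cube R d -> unit_cube R d x ->
  discrepancy A x = explicit_discrepancy (enum_fset A) x.
Proof.
move=> Acube xcube; rewrite /discrepancy /explicit_discrepancy; congr (_ - _ * _).
  rewrite card_fset_sum1 big_fset/= natr_sum big_mkcond/=.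
  apply: eq_big_seq => a aA; have acube : unit_cube R d a by exact: Acube.
  case: ifPn => [/set_mem ax|ax].
    rewrite big1// => j _; rewrite indicE mem_set//= in_itv/= andbT.
    by have /andP[] := ax j.
  have /existsNP[j jx] : ~ corner_box x a by move: ax; rewrite notin_setE.
  rewrite (bigD1 j)//= indicE memNset ?mul0r//= in_itv/= andbT => ajx.
  by apply: jx; rewrite ajx andbT; have /andP[] := acube j.
rewrite (_ : corner_box x = [set t | forall j, `[0, tnth x j[%classic (tnth t j)]); last first.
  by apply/seteqP; split => t tx j; have := tx j; rewrite /= in_itv.
rewrite (lebesgue_measure_tuple_rect (A := fun j => `[0, tnth x j[%classic)); last first.
  by move=> j; exact: measurable_itv.
rewrite [X in fine X](_ : _ = (\prod_j tnth x j)%:E)//.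
rewrite -prodEFin; apply: eq_bigr => j _; rewrite lebesgue_measure_itv/= lte_fin.
have /andP[x0 _] := xcube j; case: ltP => h; first by rewrite sube0.
by congr EFin; apply/eqP; rewrite eq_le x0 h.
Qed.
(** * Young duality for L(log L)^alpha *)

Section young_duality.
Context {R : realType}.
Implicit Types (alpha lambda a b : R) (i I : nat).

(** The part of a Young function of L(log L)^alpha that is prescribed: a lower
    bound for all of them when m is large enough ([LlogL_tail_le_young]). *)
Definition LlogL_tail alpha m a : R :=
  if m <= `|a| then `|a| * ln (3 + `|a|) `^ alpha else 0.

(** The i-th term of a series that plays the role of exp (c |b|^(1/alpha)); only
    even powers of b occur, so that moments of even order control it. *)
Definition dual_term alpha lambda i b : R :=
  expR i.+1%:R * (lambda * i.+1%:R `^ alpha) *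
  (b / (lambda * i.+1%:R `^ alpha)) ^+ i.+1.*2.

Lemma LlogL_tail_ge0 alpha m a : 0 <= LlogL_tail alpha m a.
Proof. by rewrite /LlogL_tail; case: ifP => // _; rewrite mulr_ge0// powR_ge0. Qed.

Lemma measurable_LlogL_tail alpha m : measurable_fun setT (LlogL_tail alpha m).
Proof.
apply: measurable_fun_ifT.
- by apply: measurable_fun_ler => //; exact: normr_measurable.
- apply: measurable_funM; first exact: normr_measurable.
  apply: (measurableT_comp (measurable_powR alpha)).
  apply: (measurableT_comp (@measurable_ln R)).
  by apply: measurable_funD => //; exact: normr_measurable.
- exact: measurable_cst.
Qed.

Lemma dual_term_ge0 alpha lambda i b : 0 <= lambda -> 0 <= dual_term alpha lambda i b.
Proof.
move=> l0; rewrite /dual_term -mul2n exprM; apply: mulr_ge0; last first.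
  by rewrite exprn_ge0// sqr_ge0.
by rewrite mulr_ge0 ?expR_ge0// mulr_ge0// powR_ge0.
Qed.

Lemma ln3_ge a : 1 / 2 <= ln (3 + `|a|).
Proof.
have a0 := normr_ge0 a.
rewrite -ler_expR lnK ?posrE; last by lra.
have := expR_ge1Dx (- (1 / 2 : R)); rewrite expRN => h.
have e0 := expR_gt0 (1 / 2 : R).
have := ler_wpM2r (ltW e0) h; rewrite mulVf ?gt_eqF//; lra.
Qed.

(** Let i + 1 be the integer part of 1 + ln (3 + |a|).  If
    |b| <= lambda (i+1)^alpha, the product is controlled by the function of a.
    Otherwise t = |b| / (lambda (i+1)^alpha) exceeds 1, hence is at most t^(2i+2),
    while |a| <= e^(i+1). *)
Lemma young_LlogL alpha lambda m a b I : 0 <= alpha -> 0 < lambda -> 0 <= m ->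
  ln (3 + `|a|) < I%:R ->
  `|a| * `|b| <= lambda * 3 `^ alpha * LlogL_tail alpha m a +
    (m * `|b| + \sum_(i < I) dual_term alpha lambda i b).
Proof.
move=> alpha0 lambda0 m0 aI; rewrite /LlogL_tail.
have dual0 : 0 <= \sum_(i < I) dual_term alpha lambda i b.
  by apply: sumr_ge0 => i _; rewrite dual_term_ge0// ltW.
have [ma|ma] := leP m `|a|; last first.
  by rewrite mulr0 add0r; apply: ler_wpDr => //; rewrite ler_wpM2r// ltW.
set L := ln (3 + `|a|); have L12 : 1 / 2 <= L by exact: ln3_ge.
have L0 : 0 <= L by lra.
pose i := Num.trunc L; have /andP[iL Li] := truncn_itv L0.
have iI : (i < I)%N by rewrite truncn_lt_nat.
pose c : R := i.+1%:R `^ alpha.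
have c0 : 0 < c by rewrite powR_gt0.
have cL : c <= 3 `^ alpha * L `^ alpha.
  rewrite -powRM//; apply: ge0_ler_powR => //; rewrite ?nnegrE//; first lra.
  by rewrite -natr1; move: iL; rewrite -/i; lra.
have [bc|bc] := leP `|b| (lambda * c).
  apply: ler_wpDr; first by rewrite addr_ge0// mulr_ge0.
  rewrite [leRHS](_ : _ = `|a| * (lambda * (3 `^ alpha * L `^ alpha))); last by ring.
  rewrite ler_wpM2l//; apply: le_trans bc _.
  by rewrite ler_wpM2l// ltW.
apply: ler_wpDl; first by rewrite !mulr_ge0// ?powR_ge0// ltW.
apply: ler_wpDl; first by rewrite mulr_ge0.
rewrite (bigD1 (Ordinal iI))//=; apply: ler_wpDr.
  by apply: sumr_ge0 => j _; rewrite dual_term_ge0// ltW.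
rewrite /dual_term -/c; set t := b / (lambda * c).
have lc0 : 0 < lambda * c by rewrite mulr_gt0.
have t1 : 1 <= `|t| by rewrite normrM normfV (gtr0_norm lc0) ler_pdivlMr// mul1r ltW.
have -> : `|b| = (lambda * c) * `|t|.
  by rewrite normrM normfV (gtr0_norm lc0) mulrCA divff ?mulr1// gt_eqF.
rewrite [leLHS]mulrA; apply: ler_pM => //.
- by apply: mulr_ge0 => //; exact: ltW.
- apply: ler_wpM2r; first exact: ltW.
  apply: (@le_trans _ _ (3 + `|a|)); first lra.
  have a0 := normr_ge0 a.
  by rewrite -[leLHS]lnK ?posrE ?ler_expR ?ltW//; lra.
rewrite -[t ^+ _]ger0_norm; last by rewrite -mul2n exprM exprn_ge0// sqr_ge0.
by rewrite normrX doubleS ler_eXnr.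
Qed.

End young_duality.

Section moments_dual.
Context {R : realType} {T : finType}.

Lemma sum_quarter_le1 (I : nat) : \sum_(i < I) (4^-1 : R) ^+ i.+1 <= 1.
Proof.
rewrite (_ : \sum_(i < I) _ = (1 - 4^-1 ^+ I) / 3); last first.
  elim: I => [|I IH]; first by rewrite big_ord0 expr0 subrr mul0r.
  by rewrite big_ord_recr/= IH !exprS; field.
have : 0 <= (4^-1 : R) ^+ I by rewrite exprn_ge0.
lra.
Qed.

(** The choice of lambda makes the i-th term at most lambda 4^-(i+1): the factor
    (i+1)^q of the moments is compensated by the weight (i+1)^alpha = (i+1)^(q/2)
    inside [dual_term], and the remaining weight (i+1)^alpha by (2^q)^(i+1). *)
Lemma sum_dual_term_le (q I : nat) (p : R) (g : T -> R) :
  let e := expR 1 : R in let lambda := 2 ^+ q.+1 * e in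
  0 <= p ->
  (forall k, p * \sum_x g x ^+ k.+1.*2 <= ((k.+1.*2)%:R ^+ q * e) ^+ k.+1) ->
  p * \sum_x \sum_(i < I) dual_term (q%:R / 2) lambda i (g x) <= lambda.
Proof.
move=> e lambda p0 gk.
have e1 : 1 <= e by rewrite ltW// expR_gt1.
have e0 : 0 < e by lra.
have l0 : 0 < lambda by rewrite mulr_gt0// exprn_gt0.
rewrite exchange_big mulr_sumr/=.
apply: (@le_trans _ _ (\sum_(i < I) lambda * 4^-1 ^+ i.+1)); last first.
  by rewrite -mulr_sumr ler_piMr ?(ltW l0)// sum_quarter_le1.
apply: ler_sum => i _; rewrite /dual_term -mulr_sumr.
pose c : R := i.+1%:R `^ (q%:R / 2).
have c0 : 0 < c by rewrite powR_gt0.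
have cc : c ^+ 2 = i.+1%:R ^+ q.
  rewrite /c -powR_mulrn ?powR_ge0// -powRrM -powR_mulrn//; congr (_ `^ _).
  by field.
have c_le : c <= (2 ^+ q) ^+ i.+1.
  have i1 : 1 <= i.+1%:R ^+ q :> R by rewrite exprn_ege1// ler1n.
  apply: (@le_trans _ _ (c ^+ 2)).
    rewrite ler_eXnr//; rewrite leNgt; apply/negP => c1.
    by move: i1; rewrite -cc leNgt exprn_ilt1// ltW.
  rewrite cc -exprM mulnC exprM lerXn2r ?nnegrE ?exprn_ge0//.
  by rewrite -natrX ler_nat ltnW// ltn_expl.
rewrite -/c.
under eq_bigr do rewrite expr_div_n.
rewrite -mulr_suml.
have lc : 0 < (lambda * c) ^+ i.+1.*2 by rewrite exprn_gt0// mulr_gt0.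
rewrite [leLHS](_ : _ = expR i.+1%:R * (lambda * c) / (lambda * c) ^+ i.+1.*2 *
  (p * \sum_x g x ^+ i.+1.*2)); last by ring.
apply: le_trans (ler_wpM2l _ (gk i)) _.
  by rewrite !mulr_ge0 ?expR_ge0 ?invr_ge0 ?(ltW lc)// ltW.
have -> : expR i.+1%:R = e ^+ i.+1 by rewrite -expRM_natl mulr1.
have -> : (lambda * c) ^+ i.+1.*2 = ((lambda * c) ^+ 2) ^+ i.+1 by rewrite -exprM mul2n.
rewrite [(lambda * c) ^+ 2]exprMn cc -muln2 natrM.
rewrite [(i.+1%:R * 2) ^+ q]exprMn.
have i0 : i.+1%:R ^+ q != 0 :> R by rewrite expf_neq0// pnatr_eq0.
have q0 : 2 ^+ q != 0 :> R by rewrite expf_neq0.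
have : (lambda ^+ 2 * i.+1%:R ^+ q)^-1 * (i.+1%:R ^+ q * 2 ^+ q * e) * 2 ^+ q * e = 4^-1.
  by rewrite /lambda [2 ^+ q.+1]exprS; field; rewrite i0 q0 gt_eqF.
move=> <-; rewrite [leLHS](_ : _ = lambda * (((lambda ^+ 2 * i.+1%:R ^+ q)^-1 *
  (i.+1%:R ^+ q * 2 ^+ q * e)) ^+ i.+1 * c * e ^+ i.+1)); last first.
  move: (lambda ^+ 2 * _) (i.+1%:R ^+ q * _ * e) => x y.
  by rewrite [(x^-1 * y) ^+ _]exprMn exprVn; ring.
apply: ler_wpM2l; first exact: ltW.
have : 0 <= (lambda ^+ 2 * i.+1%:R ^+ q)^-1 * (i.+1%:R ^+ q * 2 ^+ q * e).
  by rewrite !mulr_ge0 ?invr_ge0 ?mulr_ge0 ?exprn_ge0// ltW.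
move: (_^-1 * _) => z z0; rewrite [(z * 2 ^+ q * e) ^+ _]exprMn.
apply: ler_wpM2r; first by rewrite exprn_ge0// ltW.
by rewrite exprMn; apply: ler_wpM2l => //; rewrite exprn_ge0.
Qed.

End moments_dual.
(** * The lower bound *)

Lemma explicit_discrepancy_le (R : realType) (d : nat) (A : seq (d.-tuple R))
    (x : Rtuple R d) : unit_cube R d x ->
  `|explicit_discrepancy A x| <= 2 * (size A)%:R.
Proof.
move=> xcube; apply: le_trans (ler_normB _ _) _.
rewrite mulr2n mulrDl mul1r; apply: lerD.
  apply: le_trans (ler_norm_sum _ _ _) _.
  rewrite -sum1_size natr_sum; apply: ler_sum => a _; rewrite normr_prod.
  apply: prodr_ile1 => j _; rewrite normr_ge0 indicE /=.
  by rewrite normr_nat lern1 leq_b1.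
rewrite normrM ger0_norm// ler_piMr// normr_prod.
apply: prodr_ile1 => j _; have /andP[x0 x1] := xcube j.
by rewrite normr_ge0 ger0_norm.
Qed.

(** The integral hypothesis says that K is at least the norm of the discrepancy,
    up to the behaviour of the Young function on bounded sets.  For q = 0 and
    m = 0 it says that K is at least the L^1 norm. *)
Lemma LlogL_lower_bound (R : realType) (q : nat) (m : R) : 0 <= m ->
  exists2 c : R, 0 < c &
  forall (M : nat) (A : seq (q.+2.-tuple R)) (K : R), (0 < M)%N ->
    (size A)%:R * 2 ^- (q.+1 * M) <= 1 / 2 :> R ->
    2 ^- q.+2 <= (size A)%:R * 2 ^- (q.+1 * M) :> R ->
    0 < K ->
    (\int[unit_cube_measure R q.+2]_(x in unit_cube R q.+2)
      (LlogL_tail (q%:R / 2) m (explicit_discrepancy A x / K))%:E <= 1)%E ->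
    c * Num.sqrt M%:R ^+ q.+1 <= K.
Proof.
move=> m0; have [c1 c10 test] := exists_test_function R q.
pose e : R := expR 1; pose lambda : R := 2 ^+ q.+1 * e.
have e0 : 0 < e by exact: expR_gt0.
have l0 : 0 < lambda by rewrite mulr_gt0// exprn_gt0.
pose alpha : R := q%:R / 2.
have alpha0 : 0 <= alpha by rewrite divr_ge0.
pose l3 := lambda * 3 `^ alpha.
have l30 : 0 <= l3 by rewrite mulr_ge0 ?powR_ge0// ltW.
pose C := l3 + (m * (1 + 2 ^+ q * e) + lambda).
have mq0 : 0 <= m * (1 + 2 ^+ q * e).
  by rewrite mulr_ge0// addr_ge0// mulr_ge0 ?exprn_ge0// ltW.
have C0 : 0 < C by rewrite /C; lra.
exists (c1 / C) => [|M A K M0 A_le A_ge K0 intK]; first by rewrite divr_gt0.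
have [S S_ge S_mom] := test M A M0 A_le A_ge.
pose sM : R := Num.sqrt M%:R.
have sM0 : 0 < sM by rewrite sqrtr_gt0 ltr0n.
have sMM : sM ^+ 2 = M%:R by rewrite sqr_sqrtr.
pose p := mesh R (q.+1 * M) ^+ q.+2.
have p0 : 0 <= p by rewrite exprn_ge0// ltW// mesh_gt0.
pose g w := (sM ^+ q)^-1 * S w.
have g_mom k : p * \sum_w g w ^+ k.+1.*2 <= ((k.+1.*2)%:R ^+ q * e) ^+ k.+1.
  under eq_bigr do rewrite exprMn.
  rewrite -mulr_sumr mulrCA exprVn ler_pdivrMl ?exprn_gt0//.
  apply: le_trans (S_mom k) _; rewrite natrM.
  have -> : (sM ^+ q) ^+ k.+1.*2 = (M%:R ^+ q) ^+ k.+1.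
    by rewrite -mul2n exprM [(sM ^+ q) ^+ 2]exprAC sMM.
  rewrite -exprMn [(k.+1.*2%:R * M%:R) ^+ q]exprMn.
  by rewrite (_ : _ * _ * e = M%:R ^+ q * (k.+1.*2%:R ^+ q * e))//; ring.
(* The discrepancy is bounded by twice the number of points, so finitely many
   dual terms suffice. *)
pose I := (Num.trunc (ln (3 + 2 * (size A)%:R / K))).+1.
pose T w := m * `|g w| + \sum_(i < I) dual_term alpha lambda i (g w).
have pT : p * \sum_w T w <= m * (1 + 2 ^+ q * e) + lambda.
  rewrite big_split/= mulrDr; apply: lerD; last exact: sum_dual_term_le.
  rewrite -mulr_sumr mulrCA ler_wpM2l//.
  apply: (@le_trans _ _ (p * \sum_w (1 + g w ^+ 2))).
    apply: ler_wpM2l => //; apply: ler_sum => w _.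
    rewrite -real_normK ?num_real//; have := normr_ge0 (g w); nra.
  rewrite big_split/= mulrDr; apply: lerD; last by have := g_mom 0%N; rewrite expr1.
  by rewrite mulr_sumr; under eq_bigr do rewrite mulr1; rewrite sum_mesh1.
have key : pairing A g / K <= l3 + p * \sum_w T w.
  apply: (pairing_le_integral _ _ _ (fun x => l3 * LlogL_tail alpha m x)).
  - by apply: measurable_funM => //; exact: measurable_LlogL_tail.
  - by move=> x; rewrite mulr_ge0// LlogL_tail_ge0.
  - move=> w x xw; set a := _ / K; apply: le_trans (ler_norm _) _; rewrite normrM.
    apply: young_LlogL => //.
    apply: le_lt_trans (truncnS_gt _).
    have s0 : 0 <= 2 * (size A)%:R / K by rewrite divr_ge0 ?mulr_ge0// ltW.
    rewrite ler_ln ?posrE; [|by have := normr_ge0 a; lra|by lra].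
    rewrite lerD2l /a normrM normfV (gtr0_norm K0) ler_pM2r ?invr_gt0//.
    by apply: explicit_discrepancy_le; exact: box_sub_cube xw.
  - under eq_integral do rewrite EFinM.
    rewrite ge0_integralZl//=.
    + by rewrite -[leRHS]mule1 lee_wpmul2l// lee_fin.
    + exact: measurable_unit_cube.
    + apply/measurable_EFinP; apply: measurable_funTS.
      apply: measurableT_comp; first exact: measurable_LlogL_tail.
      apply: measurable_funM; last exact: measurable_cst.
      exact: measurable_explicit_discrepancy.
    + by move=> x _; rewrite lee_fin LlogL_tail_ge0.
have := le_trans key (lerD (lexx l3) pT); rewrite -/C ler_pdivrMr//.
rewrite pairingZ => h.
rewrite mulrAC ler_pdivrMr// [leRHS]mulrC; apply: le_trans h.
have sq0 : 0 < sM ^+ q by rewrite exprn_gt0.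
rewrite -ler_pdivrMl ?invr_gt0// invrK; apply: le_trans S_ge.
rewrite -/sM -sMM -exprM mulnC exprM !exprS expr0.
by rewrite le_eqVlt; apply/orP; left; apply/eqP; ring.
Qed.
Lemma young_function_ge0 (R : realType) (psi : R -> R) (x : R) :
  young_function psi -> 0 <= psi x.
Proof.
move=> [psiN psi_convex psi0 _].
have h0 : 0 <= 2^-1 :> R by [].
have h1 : 2^-1 <= 1 :> R by rewrite invf_le1// ler1n.
have := psi_convex (Itv01 h0 h1) x (- x) (in_setT _) (in_setT _).
rewrite /= !convRE /= psiN /unstable.onem.
rewrite [X in psi X](_ : _ = 2^-1 * x + (1 - 2^-1) * - x :> R)//.
rewrite (_ : 2^-1 * x + _ = 0); last by field.
by rewrite psi0 -mulrDl addrC subrK mul1r.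
Qed.

Lemma LlogL_tail_le_young (R : realType) (alpha : R) (phi : R -> R) :
  LlogL_young alpha phi ->
  exists2 m : R, 0 <= m & forall a, LlogL_tail alpha m a <= phi a.
Proof.
move=> [phi_young [m0 phi_large]]; exists (Num.max m0 0) => [|a].
  by rewrite le_max lexx orbT.
rewrite /LlogL_tail; case: ifPn => [|_]; last exact: young_function_ge0.
by rewrite ge_max => /andP[m0a _]; rewrite phi_large.
Qed.

(** M is the least integer with (q+1) M > 1 + log_2 N, log_2 rounded down. *)
Lemma dyadic_scale (R : realType) (q N : nat) : (1 <= N)%N ->
  exists M : nat, [/\ (0 < M)%N, N%:R * 2 ^- (q.+1 * M) <= 1 / 2 :> R,
    2 ^- q.+2 <= N%:R * 2 ^- (q.+1 * M) :> R & (N <= 2 ^ (q.+1 * M))%N].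
Proof.
move=> N1; pose t := trunc_log 2 N.
have /andP[tN Nt] : (2 ^ t <= N < 2 ^ t.+1)%N by exact: trunc_log_bounds.
pose M := ((t.+1 %/ q.+1).+1)%N; exists M.
have nt : (t.+2 <= q.+1 * M)%N by rewrite mulnC; exact: ltn_ceil.
have nt2 : (q.+1 * M <= t + q.+2)%N.
  have := leq_divM t.+1 q.+1; rewrite /M; lia.
have two_gt0 (k : nat) : (0 : R) < 2 ^+ k by rewrite exprn_gt0.
split => //.
- rewrite ler_pdivrMr//; apply: (@le_trans _ _ (2 ^+ t.+1)).
    by rewrite -natrX ler_nat ltnW.
  rewrite mul1r -ler_pdivrMl ?invr_gt0// invrK -exprS.
  by rewrite ler_weXn2l// ler1n.
- rewrite ler_pdivlMr// ler_pdivrMl//; apply: (@le_trans _ _ (2 ^+ (t + q.+2))).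
    by rewrite ler_weXn2l// ler1n.
  by rewrite exprD mulrC ler_wpM2l// -natrX ler_nat.
- apply: ltnW; apply: leq_trans Nt _; rewrite leq_exp2l//; exact: ltnW.
Qed.

Lemma ln_powR_le_sqrt (R : realType) (q M N : nat) : (1 <= N)%N ->
  (N <= 2 ^ (q.+1 * M))%N ->
  ln N%:R `^ (q.+1%:R / 2) <= Num.sqrt q.+1%:R ^+ q.+1 * Num.sqrt M%:R ^+ q.+1 :> R.
Proof.
move=> N1 NM.
have ln0 : 0 <= ln N%:R :> R by rewrite ln_ge0// ler1n.
rewrite mulrC powRrM powR_mulrn ?powR_ge0// powR12_sqrt// -exprMn.
rewrite lerXn2r ?nnegrE ?mulr_ge0 ?sqrtr_ge0// -sqrtrM// ler_wsqrtr//.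
rewrite -ler_expR lnK ?posrE ?ltr0n// -natrM.
apply: (@le_trans _ _ (2 ^+ (q.+1 * M))); first by rewrite -natrX ler_nat.
rewrite -[X in expR X]mulr1 expRM_natl lerXn2r ?nnegrE ?expR_ge0//.
by apply: le_trans (expR_ge1Dx 1).
Qed.

Lemma cube_integral_le (R : realType) (d : nat) (A : {fset Rtuple R d}) (K alpha m : R)
    (f : Rtuple R d -> \bar R) :
  [set` A] `<=` unit_cube R d -> (forall x, (0 <= f x)%E) ->
  (forall x, ((LlogL_tail alpha m (discrepancy A x / K))%:E <= f x)%E) ->
  (\int[unit_cube_measure R d]_(x in unit_cube R d)
    (LlogL_tail alpha m (explicit_discrepancy (enum_fset A) x / K))%:E <=
   \int[unit_cube_measure R d]_x f x)%E.
Proof.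
move=> Acube f0 tf; rewrite integral_mkcond.
apply: ge0_le_integral_nonmeasurable => x; rewrite patchE; case: ifPn => // /set_mem xcube.
  by rewrite lee_fin LlogL_tail_ge0.
by rewrite -discrepancyE.
Qed.

Theorem theorem1p1 (R : realType) (d : nat) (phi : R -> R) :
  (2 <= d)%N ->
  let alpha : R := (d%:R - 2) / 2 in
  (0 < alpha -> LlogL_young alpha phi) ->
  exists2 c : R, 0 < c &
    forall (N : nat) (A : {fset Rtuple R d}),
      (1 <= N)%N ->
      [set` A] `<=` unit_cube R d ->
      #|` A|%fset = N ->
      ((c * ln N%:R `^ ((d%:R - 1) / 2))%:E <=
        LlogL_norm (unit_cube_measure R d) alpha phi (discrepancy A))%E.
Proof.
case: d => [//|[//|q]] _ /=.
have -> : (q.+2%:R - 2) / 2 = q%:R / 2 :> R.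
  by rewrite -[q.+2]addn2 natrD addrK.
have -> : (q.+2%:R - 1) / 2 = q.+1%:R / 2 :> R.
  by rewrite -[q.+2]addn1 natrD addrK.
set alpha : R := q%:R / 2 => phi_young.
have alpha0 : 0 <= alpha by rewrite divr_ge0.
have [m m0 tail_le] : exists2 m : R, 0 <= m &
    0 < alpha -> forall a, LlogL_tail alpha m a <= phi a.
  have [a0|a0] := ltP 0 alpha; last by exists 0.
  by have [m m0 h] := LlogL_tail_le_young R alpha phi (phi_young a0); exists m.
have mm0 : 0 <= if alpha == 0 then 0 else m by case: ifP.
have [c c0 lower] := LlogL_lower_bound R q _ mm0.
have sq0 : 0 < Num.sqrt q.+1%:R ^+ q.+1 :> R by rewrite exprn_gt0// sqrtr_gt0.
exists (c / Num.sqrt q.+1%:R ^+ q.+1) => [|N A N1 Acube AN]; first by rewrite divr_gt0.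
have [M [M0 A_le A_ge NM]] := dyadic_scale R q N N1.
rewrite -AN in A_le A_ge.
set X := _ * _ `^ _.
have XK K : 0 < K ->
    (\int[unit_cube_measure R q.+2]_(x in unit_cube R q.+2)
      (LlogL_tail alpha (if alpha == 0 then 0 else m)
        (explicit_discrepancy (enum_fset A) x / K))%:E <= 1)%E -> X <= K.
  move=> K0 intK; apply: le_trans (lower M _ K M0 A_le A_ge K0 intK).
  rewrite /X -mulrA ler_wpM2l ?(ltW c0)// ler_pdivrMl//.
  exact: ln_powR_le_sqrt.
rewrite /LlogL_norm; case: ifPn XK => [/eqP alpha_eq0|alpha_neq0] XK.
  (* The norm may vanish, so K is taken slightly larger. *)
  rewrite Lnorm1; apply/lee_addgt0Pr => eps eps0.
  have norm0 : (0 <= \int[unit_cube_measure R q.+2]_x `|(EFin \o discrepancy A) x|)%E.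
    by apply: integral_ge0 => x _; exact: abse_ge0.
  have [norm_fin|] := boolP
      (\int[unit_cube_measure R q.+2]_x `|(EFin \o discrepancy A) x| < +oo)%E; last first.
    by rewrite ltey negbK => /eqP ->; rewrite leey.
  rewrite -(@fineK _ (\int[unit_cube_measure R q.+2]_x _)%E); last by rewrite ge0_fin_numE.
  rewrite -EFinD lee_fin.
  set K := fine _ + eps.
  have K0 : 0 < K by rewrite ltr_pwDr// fine_ge0.
  apply: XK => //.
  pose E := explicit_discrepancy (enum_fset A).
  have tailE x : (LlogL_tail alpha 0 (E x / K))%:E = (K^-1%:E * `|(E x)%:E|)%E.
    rewrite /LlogL_tail normr_ge0 alpha_eq0 powRr0 mulr1 normrM normfV (gtr0_norm K0).
    by rewrite mulrC EFinM abse_EFin.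
  under eq_integral do rewrite tailE.
  rewrite ge0_integralZl//; last 3 first.
  - exact: measurable_unit_cube.
  - apply: measurableT_comp => //; apply/measurable_EFinP; apply: measurable_funTS.
    exact: measurable_explicit_discrepancy.
  - by rewrite lee_fin invr_ge0 ltW.
  rewrite [leRHS](_ : _ = K^-1%:E * K%:E)%E; last by rewrite -EFinM mulVf// lt0r_neq0.
  rewrite lee_wpmul2l//; first by rewrite lee_fin invr_ge0 ltW.
  apply: (@le_trans _ _ (\int[unit_cube_measure R q.+2]_x `|(EFin \o discrepancy A) x|)%E).
    rewrite integral_mkcond.
    apply: ge0_le_integral_nonmeasurable => x; rewrite patchE.
      by case: ifP => // _; exact: abse_ge0.
    case: ifPn => [/set_mem xcube|_]; last exact: abse_ge0.
    by rewrite /= discrepancyE.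
  by rewrite /K EFinD fineK ?leeDl ?lee_fin ?(ltW eps0)// ge0_fin_numE.
apply: le_ereal_inf_tmp => _ [K [K0 EK] <-]; rewrite lee_fin; apply: XK => //.
apply: le_trans EK; rewrite unlock; apply: cube_integral_le => // x.
  rewrite lee_fin young_function_ge0//; apply: (phi_young _).1.
  by rewrite lt_neqAle eq_sym alpha_neq0.
by rewrite lee_fin tail_le// lt_neqAle eq_sym alpha_neq0.
Qed.
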